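(* For every point $x_0$ of the circle $S^1$, the spaces $SC(S^1,x_0)$ (the Snake on a square) and $AC(S^1,x_0)$ (the Alternating cone over the circle) are homotopy equivalent.
   Context: Let $\mathbb{I}=[0,1]$ and $\mathbb{N}=\{1,2,3,\dots\}$; a point of the plane with coordinates $a,b$ is written $(a;b)$. Piecewise linear Topologist sine curve: let $A=(0;0)$, $B=(0;1)$, $A_n=(1/n;0)$, $B_n=(1/n;1)$ for $n\in\mathbb{N}$; let $L=[A,B]$, $L_{2n-1}=[A_n,B_n]$, $L_{2n}=[B_n,A_{n+1}]$ be linear segments, and $\mathcal{T}=L\cup\bigcup_{n\in\mathbb{N}}L_n\subset\mathbb{I}^2\subset\mathbb{R}^2$. For a compact pointed space $(X,x)$: (SC) The Snake cone $SC(X,x)$ is the quotient space of the topological sum $(X\times\mathcal{T})\sqcup\mathbb{I}^2$ obtained by identifying $(x,t)\in X\times\mathcal{T}$ with $t\in\mathbb{I}^2$ for each $t\in\mathcal{T}\setminus L$, and identifying the whole set $X\times\{t\}$ with the point $t\in\mathbb{I}^2$ for each $t\in L$. (AC) Let $Y=X\times\{0\}\times\mathbb{I}\ \cup\ \bigcup_{n\in\mathbb{N}}X\times\{1/n\}\times\mathbb{I}\ \cup\ \{x\}\times\mathbb{I}\times\mathbb{I}\subset X\times\mathbb{I}^2$ (subspace topology). The Alternating cone $AC(X,x)$ is the quotient space of $Y$ obtained by collapsing, each to one point, the sets $X\times\{0\}\times\{y\}$ for every $y\in\mathbb{I}$ (to the point $(0;y)$), $X\times\{1/(2n-1)\}\times\{0\}$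 (to $A_{2n-1}$) and $X\times\{1/(2n)\}\times\{1\}$ (to $B_{2n}$) for every $n\in\mathbb{N}$. *)

(* Defs.v *)
From Stdlib Require Import Relation_Operators.
From HB Require Import structures.
From mathcomp Require Import all_boot all_order all_algebra.
From mathcomp Require Import all_classical all_reals all_analysis.

Set Implicit Arguments.
Unset Strict Implicit.
Unset Printing Implicit Defensive.

Import Order.TTheory GRing.Theory Num.Theory.
Import numFieldNormedType.Exports.

Local Open Scope classical_set_scope.
Local Open Scope quotient_scope.
Local Open Scope ring_scope.

Section Gluing.
Context {Z : topologicalType} (r : Z -> Z -> Prop).

Definition glue_rel : rel Z := fun p q => `[< clos_refl_sym_trans Z r p q >].

Lemma glue_rel_refl : reflexive glue_rel.
Proof. by move=> p; apply/asboolP; exact: rst_refl. Qed.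

Lemma glue_rel_sym : symmetric glue_rel.
Proof.
by move=> p q; apply: asbool_equiv_eq; split=> ?; apply: rst_sym.
Qed.

Lemma glue_rel_trans : transitive glue_rel.
Proof.
move=> q p s /asboolP pq /asboolP qs; apply/asboolP; exact: rst_trans pq qs.
Qed.

Definition glue_equiv := EquivRel glue_rel glue_rel_refl glue_rel_sym glue_rel_trans.

Definition gluing : topologicalType := quotient_topology {eq_quot glue_equiv}.

End Gluing.

Definition summand (U V : topologicalType) (b : bool) : topologicalType :=
  if b then U else V.

Definition topological_sum (U V : topologicalType) : topologicalType :=
  {b : bool & summand U V b}.

Section HomotopyEquivalence.
Variable R : realType.

Definition unit_interval : set R := `[0, 1].

Definition homotopic (U V : topologicalType) (f g : U -> V) : Prop :=
  exists H : U * unit_interval -> V,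
    [/\ continuous H,
        forall u (t : unit_interval), \val t = 0 -> H (u, t) = f u
      & forall u (t : unit_interval), \val t = 1 -> H (u, t) = g u].

Definition homotopy_equivalent (U V : topologicalType) : Prop :=
  exists (f : U -> V) (g : V -> U),
    [/\ continuous f, continuous g,
        homotopic (g \o f) id & homotopic (f \o g) id].

End HomotopyEquivalence.

Section Cones.
Variable R : realType.

Definition plane : topologicalType := (R * R)%type.

Definition segment (P Q : plane) : set plane :=
  [set ((1 - t) * P.1 + t * Q.1, (1 - t) * P.2 + t * Q.2) | t in `[0, 1]].

Definition square : set plane := `[0, 1] `*` `[0, 1].

Definition ptA (n : nat) : plane := (n%:R^-1, 0).
Definition ptB (n : nat) : plane := (n%:R^-1, 1).

Definition posnat : set nat := [set n | (0 < n)%N].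

Definition limit_seg : set plane := segment (0, 0) (0, 1).

(* The curve T: the n-th term of the union is L_(2n-1) `|` L_(2n). *)
Definition sine_curve : set plane :=
  limit_seg `|`
  \bigcup_(n in posnat) (segment (ptA n) (ptB n) `|` segment (ptB n) (ptA n.+1)).

Section SnakeCone.
Variables (X : topologicalType) (x : X).

(* Off L only the point over the base point x is glued to the square; over a
   point of L the whole fibre is. *)
Definition snake_glue (u v : topological_sum (X * sine_curve)%type square) : Prop :=
  match u, v with
  | existT true p, existT false s =>
      \val p.2 = \val s /\
      ((sine_curve `\` limit_seg) (\val p.2) /\ p.1 = x \/
       limit_seg (\val p.2))
  | _, _ => False
  end.

Definition snake_cone : topologicalType := gluing snake_glue.

End SnakeCone.

Section AlternatingCone.
Variables (X : topologicalType) (x : X).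

Definition alt_space : set (X * plane) :=
  [set: X] `*` ([set 0] `*` `[0, 1]) `|`
  \bigcup_(n in posnat) ([set: X] `*` ([set n%:R^-1] `*` `[0, 1])) `|`
  [set x] `*` (`[0, 1] `*` `[0, 1]).

Definition alt_collapsed : set (set (X * plane)) :=
  [set [set: X] `*` [set (0, y)] | y in `[0, 1]] `|`
  [set [set: X] `*` [set ptA (2 * n - 1)%N] | n in posnat] `|`
  [set [set: X] `*` [set ptB (2 * n)%N] | n in posnat].

Definition alt_glue (p q : alt_space) : Prop :=
  exists2 C, alt_collapsed C & C (\val p) /\ C (\val q).

Definition alternating_cone : topologicalType := gluing alt_glue.

End AlternatingCone.

Definition circle : set plane := [set p | p.1 ^+ 2 + p.2 ^+ 2 = 1].

End Cones.

Arguments circle : clear implicits.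

(* Main.v *)
Require Import Defs.
From mathcomp Require Import all_boot all_order all_algebra.
From mathcomp Require Import all_classical all_reals all_analysis.
From mathcomp Require Import lra ring.

(** Two consecutive segments of the snake bound a triangle, whose apex is the
    corner where they meet; the apexes are alternately at height 1 and at height
    0. Identify each point of the snake, but no other point of the square, with
    the point of the left edge at its height. The horizontal slices of a triangle
    then become loops, and the triangle becomes a cone over the circle. The result is
    an infinite sequence of cones with alternating orientations that converges
    to the left edge: turned upside down, it is the alternating cone with its
    square pushed horizontally onto the left edge.

    On the other hand, if the square of the snake cone is pushed horizontally
    onto its left edge, what remains is the product of the snake with the
    circle, with the copy of the snake over the base point projected to that
    edge. As the circle is an interval with its ends identified, this is the
    product of the snake with an interval, both ends projected to the edge.

    The two spaces are related as consecutive stages of a Puppe sequence, taken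
    over the height. The space [mapping_cone] consists of the square and of the
    fins, the product of the snake with an interval, attached along the snake at
    one end and projected to the left edge at the other end. Pushing its square
    onto the left edge gives the second space above, and shrinking its fins
    gives the first one. Accordingly, it is homotopy equivalent to the snake cone
    ([snake_tubes_mapping_cone]) and to the alternating cone
    ([mapping_cone_comb_cones]). It is here that the circle enters, as the
    suspension of two points: a fin out and another fin back make up a loop of
    the snake cone followed by the inverse of the next one.

    Nothing has to be extended over neighbourhoods, since all maps and homotopies
    are explicit. They nearly preserve heights. The exception is caused by the
    apexes, over which the fins on the two sides of a triangle meet while the
    slice between them vanishes: the maps between [mapping_cone] and the
    alternating cone squeeze the heights so that they are stationary near 0 and
    1, and use the room so obtained to contract the path that goes up a fin and
    back.

    To have continuity from formulas, each space is realized in a Euclidean space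
    as a union of two compact families of charts ([chart_space]), whose index
    set is the one-point compactification of the natural numbers. Maps and
    homotopies are given on the charts and descend by compactness
    ([map_on_charts]); they are continuous at the limit index because all
    coordinates other than the height are bounded by a multiple of the position
    of the tooth ([continuous_on_comb]). The same principle identifies the two
    given quotients with their realizations ([gluing_chart_space]). *)

Set Implicit Arguments.
Unset Strict Implicit.
Unset Printing Implicit Defensive.

Import Order.TTheory GRing.Theory Num.Theory.
Import numFieldNormedType.Exports.

Local Open Scope classical_set_scope.
Local Open Scope ring_scope.

(** * Compact charts *)

Lemma continuous_pair (X U V : topologicalType) (f : X -> U) (g : X -> V) :
  continuous f -> continuous g -> continuous (fun x => (f x, g x)).
Proof. by move=> cf cg x; apply: cvg_pair; [exact: cf|exact: cg]. Qed.

Lemma continuous_fst (U V : topologicalType) : continuous (@fst U V).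
Proof. by move=> [x y]; exact: cvg_fst. Qed.

Lemma continuous_snd (U V : topologicalType) : continuous (@snd U V).
Proof. by move=> [x y]; exact: cvg_snd. Qed.

Lemma continuous_compose (X Y Z : topologicalType) (f : X -> Y) (g : Y -> Z) :
  continuous f -> continuous g -> continuous (fun x => g (f x)).
Proof. by move=> cf cg x; apply: continuous_comp; [exact: cf|exact: cg]. Qed.

Lemma continuous_set_val (X : topologicalType) (A : set X) :
  continuous (fun x : A => \val x).
Proof. exact: initial_continuous. Qed.

Definition lift (X Y : Type) (A : set Y) (f : X -> Y) (fA : forall x, A (f x)) :
  X -> A := fun x => exist _ (f x) (mem_set (fA x)).

Lemma continuous_lift (X Y : topologicalType) (A : set Y) (f : X -> Y)
  (fA : forall x, A (f x)) : continuous f -> continuous (lift fA).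
Proof. by move=> cf; apply: continuous_comp_initial. Qed.

Lemma set_typeP (T : Type) (A : set T) (x : A) : A (\val x).
Proof. exact: set_mem (valP x). Qed.

Lemma injective_hausdorff (X Y : topologicalType) (f : X -> Y) :
  continuous f -> injective f -> hausdorff_space Y -> hausdorff_space X.
Proof.
move=> cf fi hY p q pq; apply/fi/hY => A B nA nB.
have [z [Az Bz]] := pq _ _ (cf p _ nA) (cf q _ nB).
by exists (f z).
Qed.

Lemma hausdorff_pair (X Y : topologicalType) :
  hausdorff_space X -> hausdorff_space Y -> hausdorff_space (X * Y)%type.
Proof.
move=> hX hY [p1 p2] [q1 q2] pq; congr pair.
- apply: hX => A B nA nB.
  have [z [Az Bz]] := pq _ _ (@continuous_fst X Y (p1, p2) A nA)
    (@continuous_fst X Y (q1, q2) B nB).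
  by exists z.1.
- apply: hY => A B nA nB.
  have [z [Az Bz]] := pq _ _ (@continuous_snd X Y (p1, p2) A nA)
    (@continuous_snd X Y (q1, q2) B nB).
  by exists z.2.
Qed.

Lemma compact_set_type (X : topologicalType) (A : set X) :
  compact A -> compact [set: A].
Proof.
move=> /compact_near_coveringP cA; apply/compact_near_coveringP.
move=> I F P FF FP.
suff H : \near F, A `<=` (fun x => forall Ax : x \in A, P F (exist _ x Ax)).
  by apply: filterS H => i Hi [x Ax] _; apply: (Hi x (set_mem Ax)).
apply: cA => x Ax.
have [[U V] [/= nU FV] UV] := FP (exist _ x (mem_set Ax)) Logic.I.
case: nU => W [[W' oW' <-] W'x WU].
exists (W', V); first by split => //; apply: open_nbhs_nbhs.
move=> [y i] [/= W'y Vi] Ay.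
by apply: (UV (_, _)); split => //; apply: WU.
Qed.

Lemma compact_setT_pair (X Y : topologicalType) :
  compact [set: X] -> compact [set: Y] -> compact [set: (X * Y)%type].
Proof. by move=> cX cY; rewrite -setXTT; exact: compact_setX. Qed.

(** A continuous map from a compact space to a Hausdorff space is closed, so a
    jointly surjective pair of such maps is a quotient map. *)
Lemma continuous_on_charts (Z K1 K2 B : topologicalType)
    (q1 : K1 -> Z) (q2 : K2 -> Z) (f : Z -> B) :
  hausdorff_space Z -> compact [set: K1] -> compact [set: K2] ->
  continuous q1 -> continuous q2 ->
  (forall z, (exists x, q1 x = z) \/ (exists x, q2 x = z)) ->
  continuous (fun x => f (q1 x)) -> continuous (fun x => f (q2 x)) ->
  continuous f.
Proof.
move=> hZ k1 k2 cq1 cq2 surj cf1 cf2; apply/continuous_closedP => C cC.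
have -> : f @^-1` C = q1 @` ((fun x => f (q1 x)) @^-1` C) `|`
                      q2 @` ((fun x => f (q2 x)) @^-1` C).
  apply/seteqP; split=> [z Cz|z [[x Cx <-]//|[x Cx <-]//]].
  by case: (surj z) => -[x xz]; [left|right]; exists x; rewrite //= xz.
have closed_image (K : topologicalType) (q : K -> Z) : compact [set: K] ->
    continuous q -> continuous (fun x => f (q x)) ->
    closed (q @` ((fun x => f (q x)) @^-1` C)).
  move=> kK cq /continuous_closedP/(_ _ cC) cl.
  apply: compact_closed => //; apply: continuous_compact.
    exact: continuous_subspaceT.
  exact: subclosed_compact cl kK _.
by apply: closedU; exact: closed_image.
Qed.

(** Products of compact Hausdorff spaces are again such, so the charts remain a
    quotient map after multiplication by [P]. With an interval as [P] this makes
    homotopies definable chart by chart. *)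
Lemma map_on_charts (Z K1 K2 B P : topologicalType)
    (q1 : K1 -> Z) (q2 : K2 -> Z) (f1 : K1 * P -> B) (f2 : K2 * P -> B) :
  hausdorff_space Z -> compact [set: K1] -> compact [set: K2] ->
  continuous q1 -> continuous q2 ->
  (forall z, (exists x, q1 x = z) \/ (exists x, q2 x = z)) ->
  hausdorff_space P -> compact [set: P] ->
  continuous f1 -> continuous f2 ->
  (forall x y s, q1 x = q1 y -> f1 (x, s) = f1 (y, s)) ->
  (forall x y s, q1 x = q2 y -> f1 (x, s) = f2 (y, s)) ->
  (forall x y s, q2 x = q2 y -> f2 (x, s) = f2 (y, s)) ->
  exists F : Z * P -> B, [/\ continuous F,
    forall x s, F (q1 x, s) = f1 (x, s) & forall x s, F (q2 x, s) = f2 (x, s)].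
Proof.
move=> hZ k1 k2 cq1 cq2 surj hP kP cf1 cf2 e11 e12 e22.
have /choice[F FE] : forall zs : Z * P, exists b : B,
    (forall x, q1 x = zs.1 -> f1 (x, zs.2) = b) /\
    (forall x, q2 x = zs.1 -> f2 (x, zs.2) = b).
  move=> [z s] /=; case: (surj z) => -[x <-].
  - exists (f1 (x, s)); split=> y yx; first exact: e11.
    by rewrite (e12 _ _ _ (esym yx)).
  - exists (f2 (x, s)); split=> y yx; first exact: e12.
    exact: e22.
have FE1 x s : F (q1 x, s) = f1 (x, s) by apply/esym/(proj1 (FE (q1 x, s))).
have FE2 x s : F (q2 x, s) = f2 (x, s) by apply/esym/(proj2 (FE (q2 x, s))).
exists F; split=> //.
have cq (K : topologicalType) (q : K -> Z) : continuous q ->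
    continuous (fun xs : K * P => (q xs.1, xs.2)).
  move=> cq; apply: continuous_pair; last exact: continuous_snd.
  by apply: continuous_compose cq; exact: continuous_fst.
pose p1 (xs : K1 * P) : Z * P := (q1 xs.1, xs.2).
pose p2 (xs : K2 * P) : Z * P := (q2 xs.1, xs.2).
have E1 : (fun xs => F (p1 xs)) = f1 by apply/funext => -[x s]; exact: FE1.
have E2 : (fun xs => F (p2 xs)) = f2 by apply/funext => -[x s]; exact: FE2.
apply: (@continuous_on_charts _ _ _ _ p1 p2).
- exact: hausdorff_pair.
- exact: compact_setT_pair.
- exact: compact_setT_pair.
- exact: cq.
- exact: cq.
- by move=> [z s]; case: (surj z) => -[x <-]; [left|right]; exists (x, s).
- by rewrite E1.
- by rewrite E2.
Qed.

(** * Real functions and the unit interval *)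

Section RealContinuity.
Variables (R : realType) (X : topologicalType).
Implicit Types f g : X -> R.

Lemma continuous_add f g :
  continuous f -> continuous g -> continuous (fun x => f x + g x).
Proof. by move=> cf cg x; apply: (@continuousD _ R^o); [exact: cf|exact: cg]. Qed.

Lemma continuous_opp f : continuous f -> continuous (fun x => - f x).
Proof. by move=> cf x; apply: (@continuousN _ R^o); exact: cf. Qed.

Lemma continuous_mul f g :
  continuous f -> continuous g -> continuous (fun x => f x * g x).
Proof. by move=> cf cg x; apply: (@continuousM R); [exact: cf|exact: cg]. Qed.

Lemma continuous_inv f :
  (forall x, f x != 0) -> continuous f -> continuous (fun x => (f x)^-1).
Proof. by move=> f0 cf x; apply: (@continuousV R) => //; exact: cf. Qed.

Lemma continuous_minr f g :
  continuous f -> continuous g -> continuous (fun x => Num.min (f x) (g x)).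
Proof. by move=> cf cg x; apply: continuous_min; [exact: cf|exact: cg]. Qed.

Lemma continuous_maxr f g :
  continuous f -> continuous g -> continuous (fun x => Num.max (f x) (g x)).
Proof. by move=> cf cg x; apply: continuous_max; [exact: cf|exact: cg]. Qed.

Lemma continuous_const (Y : topologicalType) (y : Y) :
  continuous (fun _ : X => y).
Proof. by move=> x; exact: cvg_cst. Qed.

End RealContinuity.

Lemma min_spec (R : realDomainType) (x y : R) :
  (x <= y /\ Num.min x y = x) \/ (y <= x /\ Num.min x y = y).
Proof. by case: (leP x y) => xy; [left|right; split => //; apply: ltW]. Qed.

Lemma max_spec (R : realDomainType) (x y : R) :
  (x <= y /\ Num.max x y = y) \/ (y <= x /\ Num.max x y = x).
Proof. by case: (leP x y) => xy; [left|right; split => //; apply: ltW]. Qed.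

(* Replaces every minimum and maximum by one of its arguments. *)
Ltac elim_minmax :=
  repeat match goal with
  | |- context [Num.min ?x ?y] =>
      case: (min_spec x y) => -[] ? ->
  | |- context [Num.max ?x ?y] =>
      case: (max_spec x y) => -[] ? ->
  | H : context [Num.min ?x ?y] |- _ =>
      move: H; case: (min_spec x y) => -[] ? -> ?
  | H : context [Num.max ?x ?y] |- _ =>
      move: H; case: (max_spec x y) => -[] ? -> ?
  end.

Section Clamp.
Variable R : realType.
Implicit Types x : R.

Definition clamp x : R := Num.max 0 (Num.min 1 x).

Lemma clamp_itv x : 0 <= clamp x <= 1.
Proof. by rewrite /clamp; elim_minmax; lra. Qed.

Lemma clamp_id x : 0 <= x <= 1 -> clamp x = x.
Proof. by rewrite /clamp => ?; elim_minmax; lra. Qed.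

Lemma clamp_le0 x : x <= 0 -> clamp x = 0.
Proof. by rewrite /clamp => ?; elim_minmax; lra. Qed.

Lemma clamp_ge1 x : 1 <= x -> clamp x = 1.
Proof. by rewrite /clamp => ?; elim_minmax; lra. Qed.

Lemma continuous_clamp (X : topologicalType) (f : X -> R) :
  continuous f -> continuous (fun y => clamp (f y)).
Proof.
move=> cf; apply: continuous_maxr; first exact: continuous_const.
by apply: continuous_minr => //; exact: continuous_const.
Qed.

Lemma unit_itvP x : @unit_interval R x <-> 0 <= x <= 1.
Proof. by rewrite /unit_interval /= in_itv. Qed.

Lemma unit_val_itv (t : @unit_interval R) : 0 <= \val t <= 1.
Proof. exact/unit_itvP/(set_typeP t). Qed.

Definition to_unit : R -> @unit_interval R :=
  lift (fun x => proj2 (unit_itvP (clamp x)) (clamp_itv x)).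

Lemma to_unitE x : 0 <= x <= 1 -> \val (to_unit x) = x.
Proof. exact: clamp_id. Qed.

Lemma continuous_to_unit : continuous to_unit.
Proof. by apply: continuous_lift; apply: (@continuous_clamp R id) => x. Qed.

Lemma compact_unit : compact [set: @unit_interval R].
Proof. by apply: compact_set_type; exact: segment_compact. Qed.

Lemma hausdorff_real : hausdorff_space R.
Proof. exact: Rhausdorff. Qed.

Lemma hausdorff_unit : hausdorff_space (@unit_interval R).
Proof.
apply: injective_hausdorff hausdorff_real; last exact: val_inj.
exact: continuous_set_val.
Qed.

End Clamp.

(** * Homotopy equivalence *)

Section Homotopy.
Variable R : realType.
Notation I := (@unit_interval R).

Lemma homotopic_trans (U V : topologicalType) (f g h : U -> V) :
  homotopic R f g -> homotopic R g h -> homotopic R f h.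
Proof.
move=> [F [cF F0 F1]] [G [cG G0 G1]].
pose a (us : U * I) : U * I := (us.1, to_unit (2 * \val us.2)).
pose b (us : U * I) : U * I := (us.1, to_unit (2 * \val us.2 - 1)).
pose H (us : U * I) := if \val us.2 <= 2^-1 then F (a us) else G (b us).
have cv : continuous (fun us : U * I => \val us.2).
  by apply: continuous_compose (@continuous_set_val _ _); exact: continuous_snd.
have ca : continuous (fun us => F (a us)).
  apply: continuous_compose cF; apply: continuous_pair; first exact: continuous_fst.
  apply: continuous_compose (@continuous_to_unit R).
  by apply: continuous_mul => //; exact: continuous_const.
have cb : continuous (fun us => G (b us)).
  apply: continuous_compose cG; apply: continuous_pair; first exact: continuous_fst.
  apply: continuous_compose (@continuous_to_unit R).
  apply: continuous_add; last exact: continuous_const.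
  by apply: continuous_mul => //; exact: continuous_const.
exists H; split.
- apply/continuous_closedP => C cC.
  have -> : H @^-1` C =
      ((fun us => F (a us)) @^-1` C `&` [set us | \val us.2 <= 2^-1]) `|`
      ((fun us => G (b us)) @^-1` C `&` [set us | 2^-1 <= \val us.2]).
    apply/seteqP; split=> [us|us]; rewrite /H /=.
      by case: ifPn => [? ?|/negP us2 ?]; [left|right; split=> //; lra].
    move=> [[HC /= ->]//|[HC us2]].
    case: ifPn => // us2'; have e : \val us.2 = 2^-1 by apply/le_anti/andP.
    rewrite /a F1; last by rewrite e to_unitE; lra.
    by move: HC; rewrite /b G0 // e to_unitE; lra.
  have cl (P : set R) : closed P -> closed [set us : U * I | P (\val us.2)].
    by move=> cP; move/continuous_closedP: cv; apply.
  apply: closedU; apply: closedI.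
  + by move/continuous_closedP: ca; apply.
  + by apply: (cl [set x | x <= 2^-1]); exact: closed_le.
  + by move/continuous_closedP: cb; apply.
  + by apply: (cl [set x | 2^-1 <= x]); exact: closed_ge.
- move=> u t t0; rewrite /H /= t0 ifT; last by lra.
  by rewrite /a /= F0 // t0 to_unitE; lra.
- move=> u t t1; rewrite /H /= t1 ifF; last by apply/negP; lra.
  by rewrite /b /= G1 // t1 to_unitE; lra.
Qed.

Lemma homotopic_refl (U V : topologicalType) (f : U -> V) :
  continuous f -> homotopic R f f.
Proof.
move=> cf; exists (fun us => f us.1); split=> //.
by apply: continuous_compose cf; exact: continuous_fst.
Qed.

Lemma homotopic_comp (U V W X : topologicalType) (a : U -> V) (f g : V -> W)
    (b : W -> X) : continuous a -> continuous b ->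
  homotopic R f g -> homotopic R (b \o f \o a) (b \o g \o a).
Proof.
move=> ca cb [F [cF F0 F1]].
exists (fun us => b (F (a us.1, us.2))); split=> [|u t t0|u t t1] /=.
- apply: continuous_compose cb; apply: continuous_compose cF.
  apply: continuous_pair; last exact: continuous_snd.
  by apply: continuous_compose ca; exact: continuous_fst.
- by rewrite F0.
- by rewrite F1.
Qed.

Lemma homotopy_equivalent_trans (U V W : topologicalType) :
  homotopy_equivalent R U V -> homotopy_equivalent R V W ->
  homotopy_equivalent R U W.
Proof.
move=> [f [g [cf cg gf fg]]] [f' [g' [cf' cg' gf' fg']]].
exists (fun x => f' (f x)), (fun x => g (g' x)); split.
- exact: continuous_compose.
- exact: continuous_compose.
- exact: homotopic_trans (homotopic_comp cf cg gf') gf.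
- exact: homotopic_trans (homotopic_comp cg' cf' fg) fg'.
Qed.

Lemma homotopy_equivalent_sym (U V : topologicalType) :
  homotopy_equivalent R U V -> homotopy_equivalent R V U.
Proof. by move=> [f [g [cf cg gf fg]]]; exists g, f. Qed.

Lemma homeomorphic_homotopy_equivalent (U V : topologicalType)
    (f : U -> V) (g : V -> U) : continuous f -> continuous g ->
  cancel f g -> cancel g f -> homotopy_equivalent R U V.
Proof.
move=> cf cg fK gK; exists f, g; split=> //.
- have -> : g \o f = id by apply/funext => x; exact: fK.
  by apply: homotopic_refl => x.
- have -> : f \o g = id by apply/funext => x; exact: gK.
  by apply: homotopic_refl => x.
Qed.

End Homotopy.

(** * The teeth of a comb, and the segments of the snake *)

Section Comb.
Variable R : realType.

Implicit Types (a b t : R) (n m : nat).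

(** Indexes an infinite family of teeth or segments together with the limit
    [None] of the family; the topology makes every chart indexed by it compact. *)
Definition comb_index : topologicalType := one_point_compactification nat.

Lemma compact_index : compact [set: comb_index].
Proof. exact: one_point_compactification_compact. Qed.

Lemma hausdorff_nat : hausdorff_space nat.
Proof. exact: discrete_hausdorff. Qed.

Lemma nbhs_Some (n : nat) : nbhs (Some n : comb_index) [set Some n].
Proof.
rewrite (_ : [set Some n] = Some @` [set n]); last by rewrite image_set1.
by apply: one_point_compactification_some_nbhs; exact: discrete_set1.
Qed.

Definition tooth (i : comb_index) : R := if i is Some n then n.+1%:R^-1 else 0.

Lemma tooth_ge0 i : 0 <= tooth i.
Proof. by case: i => [n|] //=; rewrite invr_ge0. Qed.

Lemma tooth_gt0 n : 0 < tooth (Some n).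
Proof. by rewrite /= invr_gt0. Qed.

Lemma tooth_le1 i : tooth i <= 1.
Proof. by case: i => [n|] //=; rewrite invf_le1 ?ltr0n // ler1n. Qed.

Lemma tooth_inj : injective tooth.
Proof.
move=> [n|] [m|] //=.
- by move=> /invr_inj/eqP; rewrite eqr_nat => /eqP[->].
- by move=> e; have := tooth_gt0 n; rewrite /= e ltxx.
- by move=> e; have := tooth_gt0 m; rewrite /= -e ltxx.
Qed.

(** Only finitely many teeth have at least a given positive position, and the
    complement of a finite set is a neighbourhood of [None]. *)
Lemma near_None (e : R) : 0 < e -> \forall i \near (None : comb_index), tooth i < e.
Proof.
move=> e0; pose N := Num.truncn e^-1.
have cN : compact `I_N.+1 by apply: finite_compact; exact: finite_II.
exists `I_N.+1; first by split=> //; apply: compact_closed => //; exact: hausdorff_nat.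
move=> _ [[n /negP /= nN <-]|->] //=.
rewrite -(invrK e) ltf_pV2 ?posrE ?invr_gt0 ?ltr0n //.
apply: (lt_le_trans (truncnS_gt _)).
by rewrite ler_nat leqW // leqNgt.
Qed.

(** On each tooth separately nothing is required but continuity; near the limit
    of the comb the bound forces the values to the limit value zero. *)
Lemma continuous_on_comb (X : topologicalType) (i : X -> comb_index) (f : X -> R)
    (F : nat -> X -> R) (C : R) :
  continuous i -> (forall n, continuous (F n)) ->
  (forall x n, i x = Some n -> f x = F n x) ->
  (forall x, `|f x| <= C * tooth (i x)) -> continuous f.
Proof.
move=> ci cF fF bf x; case ix: (i x) => [n|].
- have near_x : \forall y \near x, F n y = f y.
    have := ci x [set Some n]; rewrite ix => /(_ (@nbhs_Some n)).
    apply: (@filterS _ (nbhs x) _ [set y | i y = Some n]) => y iy.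
    by rewrite (fF _ _ iy).
  rewrite /continuous_at (fF _ _ ix).
  exact: cvg_trans (near_eq_cvg near_x) (cF n x).
- have fx0 : f x = 0.
    by apply/eqP; rewrite -normr_le0; have := bf x; rewrite ix /= mulr0.
  rewrite /continuous_at fx0; apply/cvgrPdist_lt => e e0.
  have C1 : 0 < `|C| + 1 by rewrite ltr_wpDl.
  have := ci x [set j | tooth j < e / (`|C| + 1)].
  rewrite ix => /(_ (near_None (divr_gt0 e0 C1))).
  apply: (@filterS _ (nbhs x) _ [set y | tooth (i y) < e / (`|C| + 1)]) => y /=.
  rewrite ltr_pdivlMr // sub0r normrN => ye.
  apply: le_lt_trans (bf y) (le_lt_trans _ ye).
  rewrite mulrC; apply: ler_wpM2l; first exact: tooth_ge0.
  by rewrite (le_trans (ler_norm _)) // lerDl.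
Qed.

Lemma continuous_tooth (X : topologicalType) (i : X -> comb_index) :
  continuous i -> continuous (fun x => tooth (i x)).
Proof.
move=> ci; apply: (@continuous_on_comb _ i _ (fun n _ => tooth (Some n)) 1) => //.
- by move=> n; exact: continuous_const.
- by move=> x n ->.
- by move=> x; rewrite mul1r ger0_norm // tooth_ge0.
Qed.

Definition next (i : comb_index) : comb_index := omap succn i.

(** The abscissa at height [b] of the segment L_(n+1) of the snake, which is
    vertical for even [n] and slanted for odd [n]; [None] is the limit segment. *)
Definition snake (i : comb_index) (b : R) : R :=
  if i is Some n then
    if odd n then b * (n./2).+1%:R^-1 + (1 - b) * (n./2).+2%:R^-1
    else (n./2).+1%:R^-1
  else 0.

(** Two consecutive segments bound a triangle, whose apex is the corner where they
    meet. Its extent at height [b] is [width i b * gap i], and the corner is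
    where [width] vanishes: at height 1 for even indices, at 0 for odd ones. *)
Definition width (i : comb_index) (b : R) : R :=
  if i is Some n then if odd n then b else 1 - b else 0.

Definition gap (i : comb_index) : R :=
  if i is Some n then (n./2).+1%:R^-1 - (n./2).+2%:R^-1 else 0.

Lemma gap_gt0 n : 0 < gap (Some n).
Proof. by rewrite subr_gt0 ltf_pV2 ?posrE ?ltr0n // ltr_nat. Qed.

Lemma snake_step i b : snake i b = snake (next i) b + width i b * gap i.
Proof.
case: i => [n|] /=; last by rewrite mulr0 addr0.
case: (boolP (odd n)) => on /=; rewrite uphalf_half ?on /=.
  by rewrite add1n; ring.
by rewrite (negbTE on) add0n; ring.
Qed.

Lemma width_itv i b : 0 <= b <= 1 -> 0 <= width i b <= 1.
Proof. by case: i => [n|] /= ?; [case: (odd n)|]; lra. Qed.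

Lemma gap_ge0 i : 0 <= gap i.
Proof. by case: i => [n|] //; exact/ltW/gap_gt0. Qed.

Lemma snake_next_le i b : 0 <= b <= 1 -> snake (next i) b <= snake i b.
Proof.
move=> b01; rewrite (snake_step i) lerDl mulr_ge0 ?gap_ge0 //.
by case/andP: (width_itv i b01).
Qed.

Lemma snake_le n m b : 0 <= b <= 1 -> (n <= m)%N ->
  snake (Some m) b <= snake (Some n) b.
Proof.
move=> b01 /subnK <-; elim: (m - n)%N => [//|k IH].
exact: le_trans (snake_next_le (Some (k + n)%N) b01) IH.
Qed.

Lemma snake_lt n m b : 0 < b < 1 -> (n < m)%N ->
  snake (Some m) b < snake (Some n) b.
Proof.
move=> b01 nm; have b01' : 0 <= b <= 1 by lra.
apply: le_lt_trans (snake_le b01' nm) _.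
rewrite (snake_step (Some n)) ltrDl mulr_gt0 ?gap_gt0 //=.
by case: (odd n); lra.
Qed.

Lemma snake_bounds n b : 0 <= b <= 1 ->
  0 < snake (Some n) b <= (n./2).+1%:R^-1.
Proof.
move=> b01 /=.
have h1 : (0 : R) < (n./2).+1%:R^-1 by rewrite invr_gt0.
have h2 : (0 : R) < (n./2).+2%:R^-1 by rewrite invr_gt0.
have h3 := gap_gt0 n; rewrite /= in h3.
by move: h1 h2 h3; case: (odd n); move: _^-1 _^-1 => x y; [nra|lra].
Qed.

Lemma snake_gt0 n b : 0 <= b <= 1 -> 0 < snake (Some n) b.
Proof. by move=> /(snake_bounds n)/andP[]. Qed.

Lemma snake_ge0 i b : 0 <= b <= 1 -> 0 <= snake i b.
Proof. by case: i => [n|] // ?; exact/ltW/snake_gt0. Qed.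

Lemma snake_le1 i b : 0 <= b <= 1 -> snake i b <= 1.
Proof.
case: i => [n|] // /(snake_bounds n)/andP[_ /le_trans]; apply.
by rewrite invf_le1 ?ltr0n // ler1n.
Qed.

Lemma snake_le_tooth i b : 0 <= b <= 1 -> snake i b <= 2 * tooth i.
Proof.
case: i => [n|] /=; last by rewrite mulr0.
move=> /(snake_bounds n)/andP[_ /le_trans]; apply.
rewrite ler_pdivlMr ?ltr0n // mulrC ler_pdivrMr ?ltr0n // -natrM ler_nat.
by rewrite mulnS mul2n -[X in (X < _)%N]odd_double_half; case: (odd n).
Qed.

Lemma continuous_snake_segment (X : topologicalType) (n : nat) (b : X -> R) :
  continuous b -> continuous (fun x => snake (Some n) (b x)).
Proof.
move=> cb /=; case: (odd n); last exact: continuous_const.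
apply: continuous_add; apply: continuous_mul => //; try exact: continuous_const.
by apply: continuous_add; [exact: continuous_const|exact: continuous_opp].
Qed.

Lemma continuous_snake (X : topologicalType) (i : X -> comb_index) (b : X -> R) :
  continuous i -> continuous b -> (forall x, 0 <= b x <= 1) ->
  continuous (fun x => snake (i x) (b x)).
Proof.
move=> ci cb b01.
apply: (@continuous_on_comb _ i _ (fun n x => snake (Some n) (b x)) 2) => //.
- by move=> n; exact: continuous_snake_segment.
- by move=> x n ->.
- by move=> x; rewrite ger0_norm ?snake_le_tooth ?snake_ge0.
Qed.

Lemma continuous_snake_next (X : topologicalType) (i : X -> comb_index)
    (b : X -> R) :
  continuous i -> continuous b -> (forall x, 0 <= b x <= 1) ->
  continuous (fun x => snake (next (i x)) (b x)).
Proof.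
move=> ci cb b01.
apply: (@continuous_on_comb _ i _ (fun n x => snake (Some n.+1) (b x)) 2) => //.
- by move=> n; exact: continuous_snake_segment.
- by move=> x n ->.
- move=> x; rewrite ger0_norm ?snake_ge0 //.
  exact: le_trans (snake_next_le _ (b01 x)) (snake_le_tooth _ (b01 x)).
Qed.

Lemma snake_inj i j b : 0 <= b <= 1 -> snake i b = snake j b ->
  [\/ i = j, b = 0 | b = 1].
Proof.
move=> b01; have [->|b0] := eqVneq b 0; first by move=> _; exact: Or32.
have [->|b1] := eqVneq b 1; first by move=> _; exact: Or33.
have b01' : 0 < b < 1.
  by rewrite !lt_neqAle b1 eq_sym b0; case/andP: b01 => -> ->.
case: i j => [n|] [m|] //; last by move=> *; exact: Or31.
- case: (ltngtP n m) => [nm|mn|->]; last by move=> *; exact: Or31.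
  + by move=> e; have := snake_lt b01' nm; rewrite e ltxx.
  + by move=> e; have := snake_lt b01' mn; rewrite e ltxx.
- by move=> /= e; have := snake_gt0 n b01; rewrite {1}/snake e ltxx.
- by move=> /= e; have := snake_gt0 m b01; rewrite {1}/snake -e ltxx.
Qed.

(** Runs with [t] through the slice at height [b] of the triangle between the
    segments [next i] and [i]. *)
Definition slice (i : comb_index) (t b : R) : R :=
  snake (next i) b + t * (snake i b - snake (next i) b).

Lemma slice0 i b : slice i 0 b = snake (next i) b.
Proof. by rewrite /slice mul0r addr0. Qed.

Lemma slice1 i b : slice i 1 b = snake i b.
Proof. by rewrite /slice mul1r addrC subrK. Qed.

Lemma sliceE i t b : slice i t b = snake (next i) b + t * (width i b * gap i).
Proof. by rewrite /slice (snake_step i) addrAC subrr add0r. Qed.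

Lemma slice_width0 i t b : width i b = 0 -> slice i t b = snake i b.
Proof. by move=> w; rewrite sliceE (snake_step i) w mul0r mulr0. Qed.

Lemma slice_bounds i t b : 0 <= t <= 1 -> 0 <= b <= 1 ->
  snake (next i) b <= slice i t b <= snake i b.
Proof. by move=> t01 b01; have := snake_next_le i b01; rewrite /slice; nra. Qed.

Lemma slice_itv i t b : 0 <= t <= 1 -> 0 <= b <= 1 -> 0 <= slice i t b <= 1.
Proof.
move=> t01 b01; have /andP[lo hi] := slice_bounds i t01 b01.
by rewrite (le_trans (snake_ge0 _ b01) lo) (le_trans hi (snake_le1 _ b01)).
Qed.

Lemma snake_itv i b : 0 <= b <= 1 -> 0 <= snake i b <= 1.
Proof. by move=> b01; rewrite snake_ge0 ?snake_le1. Qed.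

Lemma scaled_itv (x y : R) : 0 <= x <= 1 -> 0 <= y <= 1 -> 0 <= x * y <= 1.
Proof. by move=> *; nra. Qed.

Lemma slice_eq_top i t b : slice i t b = snake i b ->
  [\/ i = None, t = 1 | width i b = 0].
Proof.
case: i => [n|]; last by move=> *; exact: Or31.
rewrite sliceE (snake_step (Some n) b) => /addrI/eqP.
rewrite -subr_eq0 -{2}[_ * gap _]mul1r -mulrBl mulf_eq0 subr_eq0.
case/orP => [/eqP ->|]; first exact: Or32.
rewrite mulf_eq0 => /orP[/eqP ->|]; first exact: Or33.
by rewrite gt_eqF // gap_gt0.
Qed.

Lemma slice_eq_bottom i t b : slice i t b = snake (next i) b ->
  [\/ i = None, t = 0 | width i b = 0].
Proof.
case: i => [n|]; last by move=> *; exact: Or31.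
rewrite sliceE -[RHS]addr0 => /addrI/eqP; rewrite mulf_eq0.
case/orP => [/eqP ->|]; first exact: Or32.
rewrite mulf_eq0 => /orP[/eqP ->|]; first exact: Or33.
by rewrite gt_eqF // gap_gt0.
Qed.

(** The triangles fill the square: the first segment that does not pass to the
    right of a given point is the left side of a triangle that contains it,
    unless it is the right edge of the square. *)
Lemma slice_surj a b : 0 <= a <= 1 -> 0 <= b <= 1 ->
  exists i t, 0 <= t <= 1 /\ slice i t b = a.
Proof.
move=> a01' b01; have [->|a0] := eqVneq a 0.
  by exists None, 0; split; [lra|rewrite slice0].
have {a01'} a01 : 0 < a <= 1 by rewrite lt0r a0.
have ex_n : exists n, snake (Some n) b <= a.
  exists (Num.truncn a^-1).*2.
  apply: le_trans (andP (snake_bounds _ b01)).2 _.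
  rewrite doubleK -[leRHS]invrK lef_pV2 ?posrE ?invr_gt0 ?ltr0n //; last by lra.
  by rewrite ltW // truncnS_gt.
case: (ex_minnP ex_n) => -[|m] am mmin.
  have a1 : a = snake (Some 0%N) b.
    by apply/le_anti; rewrite am /= invr1; lra.
  by exists (Some 0%N), 1; split; [lra|rewrite slice1].
have lt_a : a < snake (Some m) b.
  by rewrite ltNge; apply/negP => /mmin; rewrite ltnn.
pose d := snake (Some m) b - snake (Some m.+1) b.
have d0 : 0 < d by rewrite /d; lra.
exists (Some m), ((a - snake (Some m.+1) b) / d).
have -> t : slice (Some m) t b = snake (Some m.+1) b + t * d by [].
split; last by rewrite divfK ?lt0r_neq0 // addrC subrK.
apply/andP; split; first by rewrite divr_ge0 ?(ltW d0) // subr_ge0.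
by rewrite ler_pdivrMr // mul1r /d lerD2r ltW.
Qed.

End Comb.

(** * Ramps, loops and the continuity of formulas *)

Section Coordinate.
Variable R : realType.
Notation I := (@unit_interval R).

Definition coord (t : I) : R := \val t.

Lemma coord_itv (t : I) : 0 <= coord t <= 1.
Proof. exact: unit_val_itv. Qed.

Lemma coordK (x : R) : 0 <= x <= 1 -> coord (to_unit x) = x.
Proof. exact: to_unitE. Qed.

Lemma continuous_coord (X : topologicalType) (t : X -> I) :
  continuous t -> continuous (fun x => coord (t x)).
Proof. by move=> ct; apply: continuous_compose ct _; exact: continuous_set_val. Qed.

End Coordinate.

Lemma continuous_fst_of (X U V : topologicalType) (f : X -> U * V) :
  continuous f -> continuous (fun x => (f x).1).
Proof. by move=> cf; apply: continuous_compose cf _; exact: continuous_fst. Qed.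

Lemma continuous_snd_of (X U V : topologicalType) (f : X -> U * V) :
  continuous f -> continuous (fun x => (f x).2).
Proof. by move=> cf; apply: continuous_compose cf _; exact: continuous_snd. Qed.

Lemma continuous_idfun (X : topologicalType) : continuous (fun x : X => x).
Proof. by move=> x. Qed.

Section Ramp.
Variable R : realType.
Implicit Types u v t : R.

Definition ramp u v t : R := clamp ((t - u) / (v - u)).

Lemma ramp_itv u v t : 0 <= ramp u v t <= 1.
Proof. exact: clamp_itv. Qed.

Lemma ramp_le u v t : u < v -> t <= u -> ramp u v t = 0.
Proof.
by move=> uv tu; rewrite /ramp clamp_le0 // mulr_le0_ge0 ?invr_ge0; lra.
Qed.

Lemma ramp_ge u v t : u < v -> v <= t -> ramp u v t = 1.
Proof.
by move=> uv tu; rewrite /ramp clamp_ge1 // ler_pdivlMr ?mul1r; lra.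
Qed.

Lemma ramp_id t : 0 <= t <= 1 -> ramp 0 1 t = t.
Proof. by move=> t01; rewrite /ramp !subr0 divr1 clamp_id. Qed.

Lemma ramp_affine u v t k l : u < v -> k * (v - u) = 1 -> l = - (k * u) ->
  ramp u v t = clamp (k * t + l).
Proof.
move=> uv kvu ->; rewrite /ramp; congr clamp.
have v0 : v - u != 0 by rewrite lt0r_neq0 // subr_gt0.
by apply: (mulIf v0); rewrite divfK // -mulrBr mulrAC kvu mul1r.
Qed.

Lemma continuous_ramp (X : topologicalType) (f g h : X -> R) :
  continuous f -> continuous g -> continuous h -> (forall x, f x < g x) ->
  continuous (fun x => ramp (f x) (g x) (h x)).
Proof.
move=> cf cg ch fg; apply: continuous_clamp; apply: continuous_mul.
  by apply: continuous_add => //; exact: continuous_opp.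
apply: continuous_inv => [x|]; first by rewrite lt0r_neq0 // subr_gt0.
by apply: continuous_add => //; exact: continuous_opp.
Qed.

End Ramp.

Section RampSymmetry.
Variable R : realType.
Implicit Types c t x y : R.

(** Heights reparametrized by a squeeze are stationary near 0 and near 1, which
    leaves room for contracting what happens over a corner of the snake. *)
Definition squeeze c t : R := ramp c (1 - c) t.

Lemma squeeze_itv c t : 0 <= squeeze c t <= 1.
Proof. exact: ramp_itv. Qed.

Lemma squeeze_le c t : c < 1/2 -> t <= c -> squeeze c t = 0.
Proof. by move=> c2 tc; apply: ramp_le; lra. Qed.

Lemma squeeze_ge c t : c < 1/2 -> 1 - c <= t -> squeeze c t = 1.
Proof. by move=> c2 tc; apply: ramp_ge; lra. Qed.

Lemma squeeze0 t : 0 <= t <= 1 -> squeeze 0 t = t.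
Proof. by move=> t01; rewrite /squeeze subr0 ramp_id. Qed.

Lemma squeezeN c t : c < 1/2 -> squeeze c (1 - t) = 1 - squeeze c t.
Proof.
move=> c2; rewrite /squeeze /ramp.
have -> : (1 - t - c) / (1 - c - c) = 1 - (t - c) / (1 - c - c).
  by field; apply/eqP; lra.
by move: (_ / _) => x; rewrite /clamp; elim_minmax; lra.
Qed.

Lemma squeeze_third t : squeeze (1/3) t = clamp (3 * t - 1).
Proof. by rewrite /squeeze (@ramp_affine _ _ _ _ 3 (-1)); lra. Qed.

Lemma squeeze_squeeze t : squeeze (1/3) (squeeze (1/3) t) = squeeze (4/9) t.
Proof.
rewrite !squeeze_third [RHS]/squeeze (@ramp_affine _ _ _ _ 9 (-4)); [|lra..].
case: (lerP (3 * t - 1) 0) => t0; first by rewrite !clamp_le0 //; lra.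
case: (lerP 1 (3 * t - 1)) => t1; first by rewrite !clamp_ge1 //; lra.
by rewrite (@clamp_id _ (3 * t - 1)); [congr clamp|]; lra.
Qed.

Lemma squeeze_min c x y : c < 1/2 ->
  squeeze c (Num.min x y) = Num.min (squeeze c x) (squeeze c y).
Proof.
move=> c2.
have mono u v : u <= v -> squeeze c u <= squeeze c v.
  move=> uv; rewrite /squeeze /ramp.
  have : (u - c) / (1 - c - c) <= (v - c) / (1 - c - c).
    by rewrite ler_pM2r ?invr_gt0; lra.
  by move: (_ / _) (_ / _) => a b ab; rewrite /clamp; elim_minmax; lra.
case: (min_spec x y) => -[xy ->]; have := mono _ _ xy => h.
  by rewrite min_l.
by rewrite min_r.
Qed.

Lemma continuous_squeeze (X : topologicalType) (f g : X -> R) :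
  continuous f -> continuous g -> (forall z, f z < 1/2) ->
  continuous (fun z => squeeze (f z) (g z)).
Proof.
move=> cf cg f2; apply: continuous_ramp => // [|z]; last by have := f2 z; lra.
by apply: continuous_add; [exact: continuous_const|exact: continuous_opp].
Qed.

(** How far from the base a path has moved at depth [x]: it stays at [l], then
    rises with slope [k] so as to be complete at depth [c]. *)
Definition level (l k c x : R) : R := Num.max l (Num.min 1 (1 + k * (x - c))).

Lemma level_itv l k c x : 0 <= l <= 1 -> 0 <= level l k c x <= 1.
Proof. by rewrite /level => l01; elim_minmax; lra. Qed.

Lemma level_ge l k c x : l <= 1 -> 0 <= k -> c <= x -> level l k c x = 1.
Proof.
move=> l1 k0 cx; have : 0 <= k * (x - c) by rewrite mulr_ge0 ?subr_ge0.
by rewrite /level; move: (k * _) => y y0; elim_minmax; lra.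
Qed.

Lemma level0 l k c : 1 - k * c <= l -> level l k c 0 = l.
Proof.
rewrite /level sub0r mulrN; move: (k * c) => y yl; elim_minmax; lra.
Qed.

Lemma continuous_level (X : topologicalType) k (l c f : X -> R) :
  continuous l -> continuous c -> continuous f ->
  continuous (fun z => level (l z) k (c z) (f z)).
Proof.
move=> cl cc cf; apply: continuous_maxr => //; apply: continuous_minr.
  exact: continuous_const.
apply: continuous_add; first exact: continuous_const.
apply: continuous_mul; first exact: continuous_const.
by apply: continuous_add => //; exact: continuous_opp.
Qed.

End RampSymmetry.

(** The displacement of a simple closed curve from its base point. As it is
    injective up to its ends, it presents its image as an interval whose ends
    are identified. *)
Record based_loop (R : realType) := BasedLoop {
  loop :> R -> R * R;
  continuous_loop : continuous loop;
  loop0 : loop 0 = (0, 0);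
  loop1 : loop 1 = (0, 0);
  loop_inj : forall t t', 0 <= t <= 1 -> 0 <= t' <= 1 -> loop t = loop t' ->
    [\/ t = t', t = 0 /\ t' = 1 | t = 1 /\ t' = 0]
}.

Section Scale.
Variable R : realType.

Definition scale (c : R) (w : R * R) : R * R := (c * w.1, c * w.2).

Lemma scale0 w : scale 0 w = (0, 0).
Proof. by rewrite /scale !mul0r. Qed.

Lemma scale_origin c : scale c (0, 0) = (0, 0).
Proof. by rewrite /scale !mulr0. Qed.

Lemma scale_inj c w w' : scale c w = scale c w' -> c = 0 \/ w = w'.
Proof.
case: w w' => [x y] [x' y'] [/= ex ey].
have [->|c0] := eqVneq c 0; [by left|right].
by rewrite (mulfI c0 ex) (mulfI c0 ey).
Qed.

Lemma continuous_scale (X : topologicalType) (c : X -> R) (w : X -> R * R) :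
  continuous c -> continuous w -> continuous (fun x => scale (c x) (w x)).
Proof.
move=> cc cw; apply: continuous_pair; apply: continuous_mul => //.
  exact: continuous_fst_of.
exact: continuous_snd_of.
Qed.

Lemma continuous_along_loop (d : based_loop R) (X : topologicalType) (t : X -> R) :
  continuous t -> continuous (fun x => d (t x)).
Proof. by move=> ct; apply: continuous_compose ct _; exact: continuous_loop. Qed.

Lemma hausdorff_plane : hausdorff_space (R * R)%type.
Proof. by apply: hausdorff_pair; exact: hausdorff_real. Qed.

End Scale.

(* Reduces the continuity of a formula to that of its atoms. *)
Ltac continuity_step :=
  match goal with
  | |- continuous (fun _ => ?y) => exact: continuous_const
  | |- continuous (fun x => x) => exact: continuous_idfun
  | |- continuous (fun x => (@?f x, @?g x)) => apply: (@continuous_pair _ _ _ f g)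
  | |- continuous (fun x => @?f x + @?g x) => apply: (@continuous_add _ _ f g)
  | |- continuous (fun x => @?f x * @?g x) => apply: (@continuous_mul _ _ f g)
  | |- continuous (fun x => - @?f x) => apply: (@continuous_opp _ _ f)
  | |- continuous (fun x => (@?f x)^-1) => apply: (@continuous_inv _ _ f)
  | |- continuous (fun x => Num.min (@?f x) (@?g x)) =>
      apply: (@continuous_minr _ _ f g)
  | |- continuous (fun x => Num.max (@?f x) (@?g x)) =>
      apply: (@continuous_maxr _ _ f g)
  | |- continuous (fun x => clamp (@?f x)) => apply: (@continuous_clamp _ _ f)
  | |- continuous (fun x => ramp (@?f x) (@?g x) (@?h x)) =>
      apply: (@continuous_ramp _ _ f g h)
  | |- continuous (fun x => squeeze (@?f x) (@?g x)) =>
      apply: (@continuous_squeeze _ _ f g)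
  | |- continuous (fun x => coord (@?f x)) => apply: (@continuous_coord _ _ f)
  | |- continuous (fun x => tooth _ (@?f x)) => apply: (@continuous_tooth _ _ f)
  | |- continuous (fun x => snake (next (@?f x)) (@?g x)) =>
      apply: (@continuous_snake_next _ _ f g)
  | |- continuous (fun x => snake (@?f x) (@?g x)) =>
      apply: (@continuous_snake _ _ f g)
  | |- continuous (fun x => scale (@?f x) (@?g x)) =>
      apply: (@continuous_scale _ _ f g)
  | |- continuous (fun x => loop ?d (@?f x)) =>
      apply: (@continuous_along_loop _ d _ f)
  | |- continuous (fun x => (@?f x).1) => apply: (@continuous_fst_of _ _ _ f)
  | |- continuous (fun x => (@?f x).2) => apply: (@continuous_snd_of _ _ _ f)
  end.
Ltac continuity := repeat continuity_step.

(** * Spaces given by two families of charts *)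

Section ChartSpace.
Variable R : realType.
Notation I := (@unit_interval R).
Notation J := comb_index.

Definition chart_space (E : Type) (p q : J -> R -> R -> E) : set E :=
  [set z | exists i t b, [/\ 0 <= t <= 1, 0 <= b <= 1 &
     z = p i t b \/ z = q i t b]].

Definition on_chart (E : Type) (p : J -> R -> R -> E) (k : J * (I * I)) : E :=
  p k.1 (coord k.2.1) (coord k.2.2).

Definition on_chart_time (E : Type) (f : J -> R -> R -> R -> E)
    (k : J * (I * I) * I) : E :=
  f k.1.1 (coord k.1.2.1) (coord k.1.2.2) (coord k.2).

Lemma compact_chart : compact [set: (J * (I * I))%type].
Proof.
apply: compact_setT_pair; first exact: compact_index.
by apply: compact_setT_pair; exact: compact_unit.
Qed.

Lemma chart_space_p (E : Type) (p q : J -> R -> R -> E) i t b :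
  0 <= t <= 1 -> 0 <= b <= 1 -> chart_space p q (p i t b).
Proof. by move=> *; exists i, t, b; split=> //; left. Qed.

Lemma chart_space_q (E : Type) (p q : J -> R -> R -> E) i t b :
  0 <= t <= 1 -> 0 <= b <= 1 -> chart_space p q (q i t b).
Proof. by move=> *; exists i, t, b; split=> //; right. Qed.

Definition induced_map (E E' : topologicalType) (A : set E')
    (p q : J -> R -> R -> E) (f g : J -> R -> R -> R -> E')
    (F : chart_space p q * I -> A) :=
  [/\ continuous F,
    forall z s i t b, 0 <= t <= 1 -> 0 <= b <= 1 -> \val z = p i t b ->
      \val (F (z, s)) = f i t b (coord s) &
    forall z s i t b, 0 <= t <= 1 -> 0 <= b <= 1 -> \val z = q i t b ->
      \val (F (z, s)) = g i t b (coord s)].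

Variables (E : topologicalType) (p q : J -> R -> R -> E).
Hypotheses (hE : hausdorff_space E) (cp : continuous (on_chart p))
  (cq : continuous (on_chart q)).

Definition chart_p : J * (I * I) -> chart_space p q :=
  lift (fun k => chart_space_p p q k.1 (coord_itv k.2.1) (coord_itv k.2.2)).
Definition chart_q : J * (I * I) -> chart_space p q :=
  lift (fun k => chart_space_q p q k.1 (coord_itv k.2.1) (coord_itv k.2.2)).

Lemma chart_space_cover (z : chart_space p q) :
  (exists k, chart_p k = z) \/ (exists k, chart_q k = z).
Proof.
case: (set_typeP z) => i [t [b [t01 b01 [e|e]]]]; [left|right];
  by exists (i, (to_unit t, to_unit b)); apply: val_inj;
     rewrite e /= !coordK.
Qed.

Lemma hausdorff_chart_space : hausdorff_space (chart_space p q).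
Proof.
apply: injective_hausdorff hE; last exact: val_inj.
exact: continuous_set_val.
Qed.

Lemma map_from_chart_space (B : topologicalType) (f g : J * (I * I) * I -> B) :
  continuous f -> continuous g ->
  (forall x y s, chart_p x = chart_p y -> f (x, s) = f (y, s)) ->
  (forall x y s, chart_p x = chart_q y -> f (x, s) = g (y, s)) ->
  (forall x y s, chart_q x = chart_q y -> g (x, s) = g (y, s)) ->
  exists F : chart_space p q * I -> B, [/\ continuous F,
    forall x s, F (chart_p x, s) = f (x, s) &
    forall x s, F (chart_q x, s) = g (x, s)].
Proof.
apply: map_on_charts.
- exact: hausdorff_chart_space.
- exact: compact_chart.
- exact: compact_chart.
- exact: continuous_lift.
- exact: continuous_lift.
- exact: chart_space_cover.
- exact: hausdorff_unit.
- exact: compact_unit.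
Qed.

(** Formulas on the charts define a homotopy once they agree wherever the charts
    overlap. *)
Lemma map_between_chart_spaces (E' : topologicalType) (A : set E')
    (f g : J -> R -> R -> R -> E') :
  continuous (on_chart_time f) -> continuous (on_chart_time g) ->
  (forall i t b s, 0 <= t <= 1 -> 0 <= b <= 1 -> 0 <= s <= 1 -> A (f i t b s)) ->
  (forall i t b s, 0 <= t <= 1 -> 0 <= b <= 1 -> 0 <= s <= 1 -> A (g i t b s)) ->
  (forall i t b i' t' b' s, 0 <= t <= 1 -> 0 <= b <= 1 ->
    0 <= t' <= 1 -> 0 <= b' <= 1 -> 0 <= s <= 1 ->
    [/\ p i t b = p i' t' b' -> f i t b s = f i' t' b' s,
        p i t b = q i' t' b' -> f i t b s = g i' t' b' s &
        q i t b = q i' t' b' -> g i t b s = g i' t' b' s]) ->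
  exists F : chart_space p q * I -> A, induced_map f g F.
Proof.
move=> cf cg Af Ag fg.
have Af' (x : J * (I * I) * I) : A (on_chart_time f x) by apply: Af; exact: coord_itv.
have Ag' (x : J * (I * I) * I) : A (on_chart_time g x) by apply: Ag; exact: coord_itv.
have cf' : continuous (lift Af') by exact: continuous_lift.
have cg' : continuous (lift Ag') by exact: continuous_lift.
have [|||F [cF Fp Fq]] := map_from_chart_space cf' cg'.
- move=> x y s /(congr1 val) /= e; apply: val_inj => /=; move: e.
  by case: (fg x.1 (coord x.2.1) (coord x.2.2) y.1 (coord y.2.1) (coord y.2.2)
    (coord s)); rewrite ?coord_itv.
- move=> x y s /(congr1 val) /= e; apply: val_inj => /=; move: e.
  by case: (fg x.1 (coord x.2.1) (coord x.2.2) y.1 (coord y.2.1) (coord y.2.2)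
    (coord s)); rewrite ?coord_itv.
- move=> x y s /(congr1 val) /= e; apply: val_inj => /=; move: e.
  by case: (fg x.1 (coord x.2.1) (coord x.2.2) y.1 (coord y.2.1) (coord y.2.2)
    (coord s)); rewrite ?coord_itv.
exists F; split=> // z s i t b t01 b01 zE.
- have -> : z = chart_p (i, (to_unit t, to_unit b)).
    by apply: val_inj; rewrite zE /= !coordK.
  by rewrite Fp /= /on_chart_time /= !coordK.
- have -> : z = chart_q (i, (to_unit t, to_unit b)).
    by apply: val_inj; rewrite zE /= !coordK.
  by rewrite Fq /= /on_chart_time /= !coordK.
Qed.

End ChartSpace.

(** * Cones over a comb, and the mapping cone of the snake *)

Section ConeSpace.
Variables (R : realType) (d : based_loop R) (pos rad : comb_index -> R -> R).
Notation I := (@unit_interval R).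

Definition ambient : topologicalType := ((R * R) * (R * R))%type.

Lemma hausdorff_ambient : hausdorff_space ambient.
Proof. by apply: hausdorff_pair; exact: hausdorff_plane. Qed.

(** The loop at position [pos i b] is scaled by [rad i b], which is taken to
    vanish exactly where a fibre has to be collapsed; this realizes the quotient
    inside a Euclidean space. For the snake cone the radius is the position
    itself, as only the fibres over the limit segment are collapsed; for the
    alternating cone it vanishes in addition at one end of each tooth. *)
Definition tube (i : comb_index) (t b : R) : ambient :=
  (scale (rad i b) (d t), (pos i b, b)).

Definition flat (a b : R) : ambient := ((0, 0), (a, b)).

Definition cone_space : set ambient :=
  chart_space tube (fun _ => flat).

Lemma continuous_flat_chart :
  continuous (on_chart (fun _ : comb_index => flat)).
Proof. by rewrite /on_chart /flat; continuity. Qed.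

(** Tubes at the same position overlap. All other overlaps occur where a loop
    passes through its base point or is collapsed, so that it lies in the square. *)
Lemma map_from_cone (E' : topologicalType) (A : set E')
    (f : comb_index -> R -> R -> R -> E') (g : R -> R -> R -> E') :
  continuous (on_chart tube) ->
  (forall i j b, 0 <= b <= 1 -> pos i b = pos j b -> rad i b = rad j b) ->
  continuous (on_chart_time f) ->
  continuous (on_chart_time (fun _ : comb_index => g)) ->
  (forall i t b s, 0 <= t <= 1 -> 0 <= b <= 1 -> 0 <= s <= 1 -> A (f i t b s)) ->
  (forall a b s, 0 <= a <= 1 -> 0 <= b <= 1 -> 0 <= s <= 1 -> A (g a b s)) ->
  (forall i j t b s, 0 <= t <= 1 -> 0 <= b <= 1 -> 0 <= s <= 1 ->
    pos i b = pos j b -> f i t b s = f j t b s) ->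
  (forall i t b s, 0 <= t <= 1 -> 0 <= b <= 1 -> 0 <= s <= 1 ->
    t = 0 \/ t = 1 \/ rad i b = 0 -> f i t b s = g (pos i b) b s) ->
  exists F : cone_space * I -> A, induced_map f (fun _ => g) F.
Proof.
move=> ct posrad cf cg Af Ag f_pos f_flat.
have ends t : 0 <= t <= 1 -> d t = (0, 0) -> t = 0 \/ t = 1.
  move=> t01; rewrite -(loop0 d) => /loop_inj[|//|->|[-> _]|[-> _]];
    by [lra|left|right].
apply: (@map_between_chart_spaces R ambient tube (fun _ => flat)
  hausdorff_ambient ct continuous_flat_chart E' A f (fun _ => g) cf cg Af
  (fun _ => Ag)).
move=> i t b i' t' b' s t01 b01 t'01 b'01 s01.
- split.
  + case=> e1 e2 epos eb; subst b'.
    have erad := posrad _ _ _ b01 epos.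
    rewrite -(f_pos i i') //.
    have : scale (rad i b) (d t) = scale (rad i b) (d t').
      by rewrite {2}erad /scale -e1 -e2.
    case/scale_inj => [rad0|/loop_inj[//|//|->//|[t0 t1]|[t1 t0]]].
    * by rewrite !f_flat //; right; right.
    * by rewrite !f_flat //; [right; left|left].
    * by rewrite !f_flat //; [left|right; left].
  + case=> e1 e2 epos eb; subst t' b'; apply: f_flat => //.
    have : scale (rad i b) (d t) = scale (rad i b) (0, 0).
      by rewrite scale_origin /scale e1 e2.
    case/scale_inj => [rad0|/ends[//|t0|t1]]; first by right; right.
    * by left.
    * by right; left.
  + by case=> -> ->.
Qed.

End ConeSpace.

Section SnakeMappingCone.
Variable R : realType.
Implicit Types (a b s t : R) (i : comb_index).
Notation I := (@unit_interval R).

Definition fin_ambient : topologicalType := ((R * R) * R)%type.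

Lemma hausdorff_fin_ambient : hausdorff_space fin_ambient.
Proof. by apply: hausdorff_pair; [exact: hausdorff_plane|exact: hausdorff_real]. Qed.

(** The interval that joins, at height [b], the left edge of the square ([t = 0])
    to the point [(a, b)] of the square ([t = 1]). For a given [b], the middle
    coordinate keeps its interior away from the square and, since its quotient by
    the first one determines [t], away from the other intervals of this kind. *)
Definition fin (t a b : R) : fin_ambient := ((t * a, t * (1 - t) * a), b).

Definition fin_chart (i : comb_index) (t b : R) := fin t (snake i b) b.
Definition slice_chart (i : comb_index) (t b : R) := fin 1 (slice i t b) b.

(** The square with the product of the snake and an interval attached to it: one
    end along the snake, the other one projected to the left edge. In terms of
    the spaces over the height, this is the mapping cone of the inclusion of the
    snake into the square. *)
Definition mapping_cone : set fin_ambient := chart_space fin_chart slice_chart.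

Lemma continuous_fin_chart : continuous (on_chart fin_chart).
Proof.
by rewrite /on_chart /fin_chart /fin; continuity => x; exact: coord_itv.
Qed.

Lemma continuous_slice_chart : continuous (on_chart slice_chart).
Proof.
by rewrite /on_chart /slice_chart /fin /slice; continuity => x; exact: coord_itv.
Qed.

Lemma fin_eq t a b t' a' b' : fin t a b = fin t' a' b' ->
  b = b' /\ (t * a = 0 /\ t' * a' = 0 \/ t = t' /\ a = a').
Proof.
case=> ex ey ->; split=> //.
have [x0|x0] := eqVneq (t * a) 0; first by left; rewrite -ex.
right.
have : (t * a) * (1 - t) = (t * a) * (1 - t').
  by rewrite {2}ex [LHS]mulrAC [RHS]mulrAC ey.
move=> /(mulfI x0)/addrI/oppr_inj tt'; split=> //.
move: ex; rewrite -tt' => /mulfI; apply.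
by apply: contraNneq x0 => ->; rewrite mul0r.
Qed.

Lemma snake_eq0 i b : 0 <= b <= 1 -> snake i b = 0 :> R -> i = None.
Proof.
by case: i => [n|] // b01 e; have := snake_gt0 n b01; rewrite e ltxx.
Qed.

Lemma slice_eq0 i t b : 0 <= t <= 1 -> 0 <= b <= 1 -> slice i t b = 0 :> R ->
  i = None.
Proof.
case: i => [n|] // t01 b01 e; have := snake_gt0 n.+1 b01.
by have := slice_bounds (Some n) t01 b01; rewrite e => /andP[/le_gtF ->].
Qed.

Lemma mapping_cone_fin i t b : 0 <= t <= 1 -> 0 <= b <= 1 ->
  mapping_cone (fin t (snake i b) b).
Proof. by move=> t01 b01; apply: (chart_space_p _ _ i t01 b01). Qed.

Lemma fin_base t a b : t * a = 0 -> fin t a b = ((0, 0), b).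
Proof. by move=> e; rewrite /fin mulrAC e mul0r. Qed.

Lemma mapping_cone_base b : 0 <= b <= 1 -> mapping_cone ((0, 0), b).
Proof.
move=> b01; rewrite -(@fin_base 0 (snake None b)) ?mul0r //.
by apply: mapping_cone_fin => //; lra.
Qed.

Lemma mapping_cone_square a b : 0 <= a <= 1 -> 0 <= b <= 1 -> mapping_cone (fin 1 a b).
Proof.
move=> a01 b01; have [i [t [t01 <-]]] := slice_surj a01 b01.
exact: (chart_space_q _ _ i t01 b01).
Qed.

(** Slices of different triangles meet on the snake only, where they also meet a
    fin. So it suffices that each slice be compatible with the fins over its two
    sides, and the fins with one another. *)
Lemma map_from_mapping_cone (E' : topologicalType) (A : set E')
    (f g : comb_index -> R -> R -> R -> E') (c : R -> R -> E') :
  continuous (on_chart_time f) -> continuous (on_chart_time g) ->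
  (forall i t b s, 0 <= t <= 1 -> 0 <= b <= 1 -> 0 <= s <= 1 -> A (f i t b s)) ->
  (forall i t b s, 0 <= t <= 1 -> 0 <= b <= 1 -> 0 <= s <= 1 -> A (g i t b s)) ->
  (forall i t b s, 0 <= t <= 1 -> 0 <= b <= 1 -> 0 <= s <= 1 ->
    t = 0 \/ i = None -> f i t b s = c b s) ->
  (forall i j t b s, 0 <= t <= 1 -> 0 <= b <= 1 -> 0 <= s <= 1 ->
    snake i b = snake j b -> f i t b s = f j t b s) ->
  (forall i t b s, 0 <= t <= 1 -> 0 <= b <= 1 -> 0 <= s <= 1 ->
    t = 1 \/ width i b = 0 -> g i t b s = f i 1 b s) ->
  (forall i b s, 0 <= b <= 1 -> 0 <= s <= 1 -> g i 0 b s = f (next i) 1 b s) ->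
  exists F : mapping_cone * I -> A, induced_map f g F.
Proof.
move=> cf cg Af Ag f_base f_snake g_top g_bottom.
have one01 : 0 <= (1 : R) <= 1 by lra.
have g_edge i t b k s : 0 <= t <= 1 -> 0 <= b <= 1 -> 0 <= s <= 1 ->
    slice i t b = snake k b -> g i t b s = f k 1 b s.
  move=> t01 b01 s01 e.
  case: i k e => [n|] [m|] e; last by rewrite g_top //; right.
  - have /andP[lo hi] := slice_bounds (Some n) t01 b01.
    case: (leqP m n) => mn.
    + have nm := snake_le b01 mn.
      have en : slice (Some n) t b = snake (Some n) b.
        by apply/le_anti; rewrite hi e nm.
      by rewrite -(f_snake (Some n)) -?en //; case: (slice_eq_top en) => // h;
        apply: g_top => //; [left|right].
    + have mn' := snake_le b01 mn.
      have en : slice (Some n) t b = snake (next (Some n)) b.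
        by apply/le_anti; rewrite lo e mn'.
      rewrite -(f_snake (next (Some n))) -?en //.
      case: (slice_eq_bottom en) => // [->|w]; first exact: g_bottom.
      rewrite g_top //; last by right.
      by apply: f_snake => //; rewrite -en slice_width0.
  - by move: (slice_eq0 t01 b01 e).
  - have := snake_gt0 m b01; rewrite -e /slice /=.
    by rewrite subrr mulr0 addr0 ltxx.
have base i t b s : 0 <= t <= 1 -> 0 <= b <= 1 -> 0 <= s <= 1 ->
    t * snake i b = 0 -> f i t b s = c b s.
  move=> t01 b01 s01 /eqP; rewrite mulf_eq0 => /orP[/eqP t0|/eqP a0].
    by apply: f_base => //; left.
  by apply: f_base => //; right; exact: snake_eq0 a0.
have gbase i t b s : 0 <= t <= 1 -> 0 <= b <= 1 -> 0 <= s <= 1 ->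
    1 * slice i t b = 0 -> g i t b s = c b s.
  move=> t01 b01 s01; rewrite mul1r => /slice_eq0 -> //.
  by rewrite g_top ?f_base //; right.
apply: (map_between_chart_spaces hausdorff_fin_ambient continuous_fin_chart
  continuous_slice_chart cf cg Af Ag).
move=> i t b i' t' b' s t01 b01 t'01 b'01 s01; split.
- case/fin_eq => eb [[x0 x0']|[et ea]]; subst b'.
    by rewrite !base.
  by subst t'; exact: f_snake.
- case/fin_eq => eb [[x0 x0']|[et ea]]; subst b'.
    by rewrite base // gbase.
  by subst t; rewrite (g_edge _ _ _ i).
- case/fin_eq => eb [[x0 x0']|[_ ea]]; subst b'.
    by rewrite !gbase.
  wlog ii' : i i' t t' t01 t'01 ea / (i = i') \/
      (exists n m, [/\ i = Some n, i' = Some m & (n < m)%N]).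
    move=> H; case: i i' ea => [n|] [m|] ea.
    + case: (ltngtP n m) => nm.
      * by apply: H => //; right; exists n, m.
      * by symmetry; apply: H => //; right; exists m, n.
      * by apply: H => //; left; rewrite nm.
    + have : slice (Some n) t b = 0 by rewrite ea /slice /= subrr mulr0 addr0.
      by move/(slice_eq0 t01 b01).
    + have : slice (Some m) t' b = 0 by rewrite -ea /slice /= subrr mulr0 addr0.
      by move/(slice_eq0 t'01 b01).
    + by apply: H => //; left.
  case: ii' => [ii'|[n [m [ei ei' nm]]]]; subst.
    have : (t - t') * (width i' b * gap R i') = 0.
      by move: ea; rewrite !sliceE => /addrI; rewrite mulrBl => ->; rewrite subrr.
    move=> /eqP; rewrite mulf_eq0 subr_eq0 => /orP[/eqP -> //|].
    rewrite mulf_eq0 => /orP[/eqP w|/eqP w].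
      by rewrite !g_top //; right.
    case: i' ea w => [n|] ea w; first by have := gap_gt0 R n; rewrite w ltxx.
    by rewrite !g_top //; right.
  have /andP[lo _] := slice_bounds (Some n) t01 b01.
  have /andP[_ hi] := slice_bounds (Some m) t'01 b01.
  have nm' := snake_le b01 nm.
  have e1 : slice (Some n) t b = snake (Some n.+1) b.
    by apply/le_anti; rewrite lo andbT ea (le_trans hi).
  by rewrite (g_edge _ _ _ (Some n.+1)) // (g_edge _ _ _ (Some n.+1)) // -ea.
Qed.

End SnakeMappingCone.

Lemma homotopy_equivalent_of_families (R : realType) (X Y : topologicalType)
    (f : X * @unit_interval R -> Y) (g : Y * @unit_interval R -> X)
    (H : X * @unit_interval R -> X) (K : Y * @unit_interval R -> Y) :
  continuous f -> continuous g -> continuous H -> continuous K ->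
  (forall x, H (x, to_unit 0) = g (f (x, to_unit 0), to_unit 0)) ->
  (forall x, H (x, to_unit 1) = x) ->
  (forall y, K (y, to_unit 0) = f (g (y, to_unit 0), to_unit 0)) ->
  (forall y, K (y, to_unit 1) = y) ->
  homotopy_equivalent R X Y.
Proof.
move=> cf cg cH cK H0 H1 K0 K1.
have at_time (t : @unit_interval R) c : 0 <= c <= 1 -> \val t = c -> t = to_unit c.
  by move=> c01 tc; apply: val_inj; rewrite to_unitE.
have slice_continuous (U V : topologicalType) (h : U * @unit_interval R -> V) :
    continuous h -> continuous (fun x => h (x, to_unit 0)).
  by move=> ch; apply: continuous_compose ch; continuity.
exists (fun x => f (x, to_unit 0)), (fun y => g (y, to_unit 0)); split.
- exact: slice_continuous.
- exact: slice_continuous.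
- by exists H; split=> // x t /at_time -> //; lra.
- by exists K; split=> // x t /at_time -> //; lra.
Qed.

(** * The snake cone and the mapping cone *)

Section SnakeTubes.
Variables (R : realType) (d : based_loop R).
Notation I := (@unit_interval R).
Notation M := (@mapping_cone R).
Implicit Types (a b s t : R) (i : comb_index).

Definition snake_tubes : set (ambient R) := cone_space d (@snake R) (@snake R).
Notation S := snake_tubes.

Lemma continuous_snake_tube :
  continuous (on_chart (tube d (@snake R) (@snake R))).
Proof.
by rewrite /on_chart /tube; continuity => x; exact: coord_itv.
Qed.

Lemma snake_tubes_tube i t b : 0 <= t <= 1 -> 0 <= b <= 1 ->
  S (tube d (@snake R) (@snake R) i t b).
Proof. by move=> t01 b01; apply: chart_space_p. Qed.

Lemma snake_tubes_flat a b : 0 <= a <= 1 -> 0 <= b <= 1 -> S (flat a b).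
Proof. by move=> a01 b01; apply: (chart_space_q _ _ None a01 b01). Qed.

(** For half of the time walk in the square from the left edge to the snake, then
    go once around the loop. *)
Definition to_tubes (i : comb_index) (t b s : R) : ambient R :=
  (scale (snake i b) (d (ramp (1/2) 1 t)), (ramp 0 (1/2) t * snake i b, b)).

Definition square_to_tubes (i : comb_index) (t b s : R) : ambient R :=
  flat (slice i t b) b.

(** For half of the time climb the fin, whose top is a point of the snake, then
    walk back in the square to the left edge. *)
Definition to_fins (i : comb_index) (t b s : R) : fin_ambient R :=
  let t' := ramp 0 (1/2) t in
  ((t' * snake i b - Num.max 0 (2 * t - 1) * snake i b, t' * (1 - t') * snake i b), b).

Definition square_to_fins (a b s : R) : fin_ambient R := ((0, 0), b).

(** A walk in the square out to the snake, then around the loop, then back. At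
    time 0 the three stages take [0, 1/4], [1/4, 1/2] and [1/2, 1], and the
    walks start and end at the left edge; at time 1 only the loop remains. *)
Definition tubes_deformation (i : comb_index) (t b s : R) : ambient R :=
  (scale (snake i b) (d (ramp ((1 - s) / 4) (1 - (1 - s) / 2) t)),
   (Num.min 1 (Num.min (s + 4 * t) (s + 2 * (1 - t))) * snake i b, b)).

Definition tubes_square_deformation (a b s : R) : ambient R := flat (s * a) b.

(** A rest at the left edge, then up the fin, then back in the square. At time 0
    the three stages take [0, 1/2], [1/2, 3/4] and [3/4, 1], and the walk reaches
    the left edge; at time 1 only the fin remains. *)
Definition fins_deformation (i : comb_index) (t b s : R) : fin_ambient R :=
  let t' := ramp ((1 - s) / 2) (1 - (1 - s) / 4) t in
  ((t' * snake i b - Num.max 0 (4 * (t - 1) + (1 - s)) * snake i b,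
    t' * (1 - t') * snake i b), b).

Definition fins_square_deformation (i : comb_index) (t b s : R) : fin_ambient R :=
  fin 1 (s * slice i t b) b.

Lemma to_tubes_low i t b s : 0 <= t <= 1/2 ->
  to_tubes i t b s = flat (2 * t * snake i b) b.
Proof.
move=> t2; rewrite /to_tubes ramp_le ?loop0 ?scale_origin; [|lra..].
by rewrite (@ramp_affine _ 0 _ _ 2 0) ?clamp_id ?addr0 //; lra.
Qed.

Lemma to_tubes_high i t b s : 1/2 <= t <= 1 ->
  to_tubes i t b s = tube d (@snake R) (@snake R) i (2 * t - 1) b.
Proof.
move=> t2; rewrite /to_tubes (@ramp_affine _ _ _ _ 2 (-1)) ?clamp_id; [|lra..].
by rewrite ramp_ge ?mul1r //; lra.
Qed.

Lemma to_tubes1 i b s : to_tubes i 1 b s = flat (snake i b) b.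
Proof.
by rewrite /to_tubes !ramp_ge ?loop1 ?scale_origin ?mul1r //; lra.
Qed.

Lemma to_fins_low i t b s : 0 <= t <= 1/2 ->
  to_fins i t b s = fin (2 * t) (snake i b) b.
Proof.
move=> t2; rewrite /to_fins (@ramp_affine _ 0 _ _ 2 0) ?clamp_id ?addr0; [|lra..].
by rewrite max_l ?mul0r ?subr0 //; lra.
Qed.

Lemma to_fins_high i t b s : 1/2 <= t <= 1 ->
  to_fins i t b s = fin 1 (2 * (1 - t) * snake i b) b.
Proof.
move=> t2; rewrite /to_fins ramp_ge ?max_r /fin; [|lra..].
by congr (_, _, _); ring.
Qed.

Lemma exists_to_tubes : exists F : M * I -> S,
  induced_map to_tubes square_to_tubes F.
Proof.
apply: (@map_from_mapping_cone R _ S to_tubes square_to_tubes (fun b _ => flat 0 b)).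
- by rewrite /on_chart_time /to_tubes; continuity => x; rewrite ?coord_itv //; lra.
- by rewrite /on_chart_time /square_to_tubes /flat /slice; continuity => x;
    exact: coord_itv.
- move=> i t b s t01 b01 _; case: (lerP t (1/2)) => t2.
    rewrite to_tubes_low; last by lra.
    by apply: snake_tubes_flat => //; apply: scaled_itv; [lra|exact: snake_itv].
  rewrite to_tubes_high; last by lra.
  by apply: snake_tubes_tube => //; lra.
- by move=> i t b s t01 b01 _; apply: snake_tubes_flat => //; exact: slice_itv.
- move=> i t b s _ b01 _ [->|->].
    by rewrite to_tubes_low ?mulr0 ?mul0r //; lra.
  by rewrite /to_tubes /flat /= scale0 mulr0.
- by move=> i j t b s _ _ _ e; rewrite /to_tubes e.
- move=> i t b s t01 b01 s01; rewrite to_tubes1 /square_to_tubes => -[->|w].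
    by rewrite slice1.
  by rewrite slice_width0.
- by move=> i b s b01 s01; rewrite /square_to_tubes slice0 to_tubes1.
Qed.

Lemma exists_to_fins : exists F : S * I -> M,
  induced_map to_fins (fun _ => square_to_fins) F.
Proof.
apply: map_from_cone.
- exact: continuous_snake_tube.
- by [].
- by rewrite /on_chart_time /to_fins; continuity => x; rewrite ?coord_itv //; lra.
- by rewrite /on_chart_time /square_to_fins; continuity.
- move=> i t b s t01 b01 _; case: (lerP t (1/2)) => t2.
    rewrite to_fins_low; last by lra.
    by apply: mapping_cone_fin => //; lra.
  rewrite to_fins_high; last by lra.
  by apply: mapping_cone_square => //; apply: scaled_itv; [lra|exact: snake_itv].
- by move=> a b s _ b01 _; exact: mapping_cone_base.
- by move=> i j t b s _ _ _ e; rewrite /to_fins e.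
- move=> i t b s _ b01 _ [->|[->|a0]]; rewrite /square_to_fins.
  + by rewrite to_fins_low ?fin_base ?mulr0 ?mul0r //; lra.
  + by rewrite to_fins_high ?subrr ?fin_base ?mulr0 ?mul0r //; lra.
  + by rewrite /to_fins a0 !mulr0 subrr.
Qed.

Lemma tubes_deformation_string i t b s :
  0 <= t <= 1 -> 0 <= b <= 1 -> 0 <= s <= 1 ->
  t <= (1 - s) / 4 \/ 1 - (1 - s) / 2 <= t ->
  tubes_deformation i t b s =
    flat (Num.min 1 (Num.min (s + 4 * t) (s + 2 * (1 - t))) * snake i b) b.
Proof.
move=> t01 b01 s01 h; rewrite /tubes_deformation /flat.
by case: h => h; [rewrite ramp_le ?loop0|rewrite ramp_ge ?loop1];
  rewrite ?scale_origin //; lra.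
Qed.

Lemma exists_tubes_deformation : exists F : S * I -> S,
  induced_map tubes_deformation (fun _ => tubes_square_deformation) F.
Proof.
apply: map_from_cone.
- exact: continuous_snake_tube.
- by [].
- rewrite /on_chart_time /tubes_deformation; continuity => x;
    rewrite ?coord_itv //.
  by have := coord_itv x.2; lra.
- by rewrite /on_chart_time /tubes_square_deformation /flat; continuity.
- move=> i t b s t01 b01 s01.
  have min01 : 0 <= Num.min 1 (Num.min (s + 4 * t) (s + 2 * (1 - t))) <= 1.
    by elim_minmax; lra.
  have [|inner] : (t <= (1 - s) / 4 \/ 1 - (1 - s) / 2 <= t) \/
      ((1 - s) / 4 < t /\ t < 1 - (1 - s) / 2) by lra.
    move=> /tubes_deformation_string -> //.
    by apply: snake_tubes_flat => //; apply: scaled_itv => //; exact: snake_itv.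
  rewrite /tubes_deformation min_l ?mul1r; last by elim_minmax; lra.
  exact: (snake_tubes_tube i (ramp_itv _ _ _)).
- move=> a b s a01 b01 s01; apply: snake_tubes_flat => //.
  exact: scaled_itv.
- by move=> i j t b s _ _ _ e; rewrite /tubes_deformation e.
- move=> i t b s t01 b01 s01 h; rewrite /tubes_square_deformation.
  case: h => [t0|[t1|a0]].
  + rewrite tubes_deformation_string //; last by left; lra.
    by congr (flat (_ * _) _); rewrite t0; elim_minmax; lra.
  + rewrite tubes_deformation_string //; last by right; lra.
    by congr (flat (_ * _) _); rewrite t1; elim_minmax; lra.
  + by rewrite /tubes_deformation a0 scale0 !mulr0.
Qed.

Lemma fins_deformation_inner i t b s : 0 <= t <= 1 - (1 - s) / 4 -> s <= 1 ->
  fins_deformation i t b s =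
    fin (ramp ((1 - s) / 2) (1 - (1 - s) / 4) t) (snake i b) b.
Proof.
by move=> t01 s1; rewrite /fins_deformation max_l ?mul0r ?subr0 //; lra.
Qed.

Lemma fins_deformation_outer i t b s : 1 - (1 - s) / 4 <= t -> 0 <= s <= 1 ->
  fins_deformation i t b s = fin 1 ((4 * (1 - t) + s) * snake i b) b.
Proof.
move=> t01 s1; rewrite /fins_deformation ramp_ge ?max_r /fin; [|lra..].
by congr (_, _, _); ring.
Qed.

Lemma exists_fins_deformation : exists F : M * I -> M,
  induced_map fins_deformation fins_square_deformation F.
Proof.
apply: (@map_from_mapping_cone R _ M _ _ (fun b _ => ((0, 0), b))).
- rewrite /on_chart_time /fins_deformation; continuity => x;
    by [exact: coord_itv|have := coord_itv x.2; lra].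
- by rewrite /on_chart_time /fins_square_deformation /fin /slice; continuity => x;
    exact: coord_itv.
- move=> i t b s t01 b01 s01; case: (lerP t (1 - (1 - s) / 4)) => t2.
    rewrite fins_deformation_inner; [|lra..].
    exact: (mapping_cone_fin i (ramp_itv _ _ _)).
  rewrite fins_deformation_outer; [|lra..].
  by apply: mapping_cone_square => //; apply: scaled_itv; [lra|exact: snake_itv].
- move=> i t b s t01 b01 s01; apply: mapping_cone_square => //.
  by apply: scaled_itv => //; exact: slice_itv.
- move=> i t b s t01 b01 s01 [t0|->].
    rewrite fins_deformation_inner; [|lra..].
    by rewrite ramp_le ?fin_base ?mul0r //; lra.
  by rewrite /fins_deformation /= !mulr0 subr0.
- by move=> i j t b s _ _ _ e; rewrite /fins_deformation e.
- move=> i t b s t01 b01 s01 h.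
  rewrite fins_deformation_outer; [|lra..].
  rewrite /fins_square_deformation subrr mulr0 add0r.
  by case: h => [->|w]; [rewrite slice1|rewrite slice_width0].
- move=> i b s b01 s01; rewrite fins_deformation_outer; [|lra..].
  by rewrite /fins_square_deformation subrr mulr0 add0r slice0.
Qed.

(** In both spaces the square can be pushed horizontally onto its left edge. What
    results is in both cases the product of the snake with an interval whose two
    ends are projected to that edge, because a circle is an interval with its
    ends identified. *)
Lemma snake_tubes_mapping_cone : homotopy_equivalent R S M.
Proof.
have [f [cf ft fs]] := exists_to_fins.
have [g [cg gf gs]] := exists_to_tubes.
have [H [cH Ht Hs]] := exists_tubes_deformation.
have [K [cK Kf Ks]] := exists_fins_deformation.
have i0 : coord (to_unit 0) = 0 :> R by rewrite coordK //; lra.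
have i1 : coord (to_unit 1) = 1 :> R by rewrite coordK //; lra.
have zero01 : 0 <= (0 : R) <= 1 by lra.
apply: (homotopy_equivalent_of_families cf cg cH cK).
- move=> z; apply: val_inj; case: (set_typeP z) => i [t [b [t01 b01 [e|e]]]].
  + have := ft _ (to_unit 0) _ _ _ t01 b01 e; rewrite (Ht _ _ _ _ _ t01 b01 e) i0.
    case: (lerP t (1/2)) => t2.
      rewrite to_fins_low; last by lra.
      move=> /(gf _ (to_unit 0) i _ b) ->; [|lra|by []]; rewrite i0.
      case: (lerP (2 * t) (1/2)) => t4.
        rewrite to_tubes_low; last by lra.
        rewrite tubes_deformation_string; [|lra..].
        by congr (flat (_ * _) _); clear -t01 t2 t4; elim_minmax; lra.
      rewrite to_tubes_high; last by lra.
      rewrite /tubes_deformation /tube (@ramp_affine _ _ _ _ 4 (-1)); [|lra..].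
      rewrite clamp_id; last by lra.
      rewrite min_l ?mul1r; last by elim_minmax; lra.
      by congr (scale _ (d _), _); lra.
    rewrite to_fins_high; last by lra.
    have a01 : 0 <= 2 * (1 - t) * snake i b <= 1.
      by apply: scaled_itv; [lra|exact: snake_itv].
    have [j [t' [t'01 ja]]] := slice_surj a01 b01.
    rewrite -ja => /(gs _ (to_unit 0) j _ b t'01 b01) ->; rewrite /square_to_tubes ja.
    rewrite tubes_deformation_string; [|lra..].
    by congr (flat (_ * _) _); clear -t01 t2; elim_minmax; lra.
  + have := fs _ (to_unit 0) i _ _ t01 b01 e; rewrite (Hs _ _ i _ _ t01 b01 e) i0.
    rewrite /square_to_fins -(@fin_base _ 1 (slice None 0 b)); last first.
      by rewrite slice0 mulr0.
    move=> /(gs _ (to_unit 0) None _ b zero01 b01) ->.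
    by rewrite /square_to_tubes slice0 /tubes_square_deformation mul0r.
- move=> z; apply: val_inj; case: (set_typeP z) => i [t [b [t01 b01 [e|e]]]].
  + rewrite (Ht _ _ _ _ _ t01 b01 e) i1 e /tubes_deformation /tube.
    by rewrite subrr !mul0r subr0 ramp_id // min_l ?mul1r //; elim_minmax; lra.
  + by rewrite (Hs _ _ i _ _ t01 b01 e) i1 e /tubes_square_deformation mul1r.
- move=> z; apply: val_inj; case: (set_typeP z) => i [t [b [t01 b01 [e|e]]]].
  + have := gf _ (to_unit 0) _ _ _ t01 b01 e; rewrite (Kf _ _ _ _ _ t01 b01 e) i0.
    case: (lerP t (1/2)) => t2.
      rewrite to_tubes_low; last by lra.
      move=> /(fs _ (to_unit 0) None _ b) ->; [|by apply: scaled_itv; [lra|exact: snake_itv]|by []].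
      rewrite fins_deformation_inner; [|lra..].
      by rewrite ramp_le ?fin_base ?mul0r //; lra.
    rewrite to_tubes_high; last by lra.
    move=> /(ft _ (to_unit 0) i _ b) ->; [|lra|by []]; rewrite i0.
    case: (lerP (2 * t - 1) (1/2)) => t4.
      rewrite to_fins_low; last by lra.
      rewrite fins_deformation_inner; [|lra..].
      rewrite (@ramp_affine _ _ _ _ 4 (-2)); [|lra..].
      rewrite clamp_id; last by lra.
      by congr fin; lra.
    rewrite to_fins_high; last by lra.
    rewrite fins_deformation_outer; [|lra..].
    by congr (fin 1 (_ * _) b); lra.
  + have := gs _ (to_unit 0) _ _ _ t01 b01 e; rewrite (Ks _ _ _ _ _ t01 b01 e) i0.
    move=> /(fs _ (to_unit 0) None _ b) ->; [|exact: slice_itv|by []].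
    by rewrite /fins_square_deformation mul0r fin_base ?mulr0.
- move=> z; apply: val_inj; case: (set_typeP z) => i [t [b [t01 b01 [e|e]]]].
  + rewrite (Kf _ _ _ _ _ t01 b01 e) i1 e fins_deformation_inner; [|lra..].
    by rewrite subrr !mul0r subr0 ramp_id.
  + by rewrite (Ks _ _ _ _ _ t01 b01 e) i1 e /fins_square_deformation mul1r.
Qed.

End SnakeTubes.

(** * The alternating cone and the mapping cone *)

Section CombCones.
Variables (R : realType) (d : based_loop R).
Notation I := (@unit_interval R).
Notation M := (@mapping_cone R).
Implicit Types (a b c k l s t : R) (i : comb_index).

Definition comb_pos i b : R := tooth R i.
Definition comb_rad i b : R := tooth R i * width i b.
Definition comb_cones : set (ambient R) := cone_space d comb_pos comb_rad.
Notation A := comb_cones.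

(** The paths below are parametrized by [t] and must be constant at the apex of a
    triangle or cone; this is the distance to that apex and to their ends. *)
Definition depth i t b : R := Num.min (Num.min t (1 - t)) (width i b).

Lemma width_squeeze i b c : 0 <= c < 1/2 ->
  width i (squeeze c b) = squeeze c (width i b).
Proof.
move=> c2; case: i => [n|] /=; last by rewrite squeeze_le; lra.
by case: (odd n) => //; rewrite squeezeN; lra.
Qed.

Lemma depth_ge0 i t b : 0 <= t <= 1 -> 0 <= b <= 1 -> 0 <= depth i t b.
Proof.
by move=> t01 /(width_itv i); rewrite /depth => ?; elim_minmax; lra.
Qed.

Lemma depth_boundary i t b : 0 <= t <= 1 -> 0 <= b <= 1 ->
  t = 0 \/ t = 1 \/ width i b = 0 -> depth i t b = 0.
Proof.
move=> t01 /(width_itv i); rewrite /depth => w01.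
by case=> [->|[->|->]]; elim_minmax; lra.
Qed.

Lemma depth_squeeze i t b c : 0 <= c < 1/2 ->
  depth i (squeeze c t) (squeeze c b) = squeeze c (depth i t b).
Proof.
by move=> c2; rewrite /depth !squeeze_min ?squeezeN ?width_squeeze //; lra.
Qed.

(** Walk in the square out to the tooth and back while the depth is at most [c],
    and go around the loop, at the squeezed height, only beyond that depth. Near
    the apex only a part of the walk is made, and the loop is trivial. *)
Definition loop_squeeze l k c i t b : ambient R :=
  (scale (tooth R i * width i (squeeze c b)) (d (squeeze c t)),
   (level l k c (depth i t b) * tooth R i, squeeze c b)).

(** Climb a fin over one side of the triangle, traverse the slice, and descend
    along the fin over the other side. Near the apex, where the squeezed slice is
    the corner itself, the path climbs only as far as the depth permits and
    returns along the same fin. *)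
Definition slice_squeeze l k c i t b : fin_ambient R :=
  fin (level l k c (depth i t b)) (slice i (squeeze c t) (squeeze c b))
    (squeeze c b).

Lemma shallow i t b c : 0 <= c < 1/2 -> depth i t b <= c ->
  [\/ squeeze c t = 0, squeeze c t = 1 | width i (squeeze c b) = 0].
Proof.
move=> c2; rewrite width_squeeze // /depth !ge_min -orbA.
case/or3P => h.
- by apply: Or31; rewrite squeeze_le //; lra.
- by apply: Or32; rewrite squeeze_ge //; lra.
- by apply: Or33; rewrite squeeze_le //; lra.
Qed.

Lemma loop_squeeze_shallow l k c i t b : 0 <= c < 1/2 -> depth i t b <= c ->
  loop_squeeze l k c i t b =
    flat (level l k c (depth i t b) * tooth R i) (squeeze c b).
Proof.
move=> c2 /(shallow c2) h; rewrite /loop_squeeze /flat.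
case: h => ->; first by rewrite loop0 scale_origin.
  by rewrite loop1 scale_origin.
by rewrite mulr0 scale0.
Qed.

Lemma slice_squeeze_shallow l k c i t b : 0 <= c < 1/2 -> depth i t b <= c ->
  exists j, slice_squeeze l k c i t b =
    fin (level l k c (depth i t b)) (snake j (squeeze c b)) (squeeze c b).
Proof.
move=> c2 /(shallow c2) h; rewrite /slice_squeeze.
case: h => [->|->|/slice_width0 ->]; [exists (next i)|exists i|exists i] => //.
  by rewrite slice0.
by rewrite slice1.
Qed.

Lemma loop_squeeze_deep l k c i t b : l <= 1 -> 0 <= k -> c <= depth i t b ->
  loop_squeeze l k c i t b = tube d comb_pos comb_rad i (squeeze c t) (squeeze c b).
Proof. by move=> l1 k0 cd; rewrite /loop_squeeze level_ge ?mul1r. Qed.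

Lemma slice_squeeze_deep l k c i t b : l <= 1 -> 0 <= k -> c <= depth i t b ->
  slice_squeeze l k c i t b = slice_chart i (squeeze c t) (squeeze c b).
Proof. by move=> l1 k0 cd; rewrite /slice_squeeze level_ge. Qed.

Lemma tooth_itv i : 0 <= tooth R i <= 1.
Proof. by rewrite tooth_ge0 tooth_le1. Qed.

Lemma comb_cones_flat a b : 0 <= a <= 1 -> 0 <= b <= 1 -> A (flat a b).
Proof. by move=> a01 b01; apply: (chart_space_q _ _ None a01 b01). Qed.

Lemma loop_squeeze_in l k c i t b : 0 <= c < 1/2 -> 0 <= l <= 1 -> 0 <= k ->
  A (loop_squeeze l k c i t b).
Proof.
move=> c2 l01 k0; case: (lerP (depth i t b) c) => h.
  rewrite loop_squeeze_shallow //; apply: comb_cones_flat; last exact: squeeze_itv.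
  by apply: scaled_itv; [exact: level_itv|exact: tooth_itv].
rewrite (loop_squeeze_deep (andP l01).2 k0 (ltW h)).
exact: (chart_space_p _ _ i (squeeze_itv _ _) (squeeze_itv _ _)).
Qed.

Lemma slice_squeeze_in l k c i t b : 0 <= c < 1/2 -> 0 <= l <= 1 -> 0 <= k ->
  M (slice_squeeze l k c i t b).
Proof.
move=> c2 l01 k0; case: (lerP (depth i t b) c) => h.
  have [j ->] := slice_squeeze_shallow l k c2 h.
  by apply: mapping_cone_fin; [exact: level_itv|exact: squeeze_itv].
rewrite (slice_squeeze_deep (andP l01).2 k0 (ltW h)).
exact: (chart_space_q _ _ i (squeeze_itv _ _) (squeeze_itv _ _)).
Qed.

Lemma continuous_width (X : topologicalType) n (b : X -> R) :
  continuous b -> continuous (fun x => width (Some n) (b x)).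
Proof. by move=> cb /=; case: (odd n) => //; continuity. Qed.

Lemma continuous_depth (X : topologicalType) n (t b : X -> R) :
  continuous t -> continuous b -> continuous (fun x => depth (Some n) (t x) (b x)).
Proof.
move=> ct cb; rewrite /depth; apply: continuous_minr; first by continuity.
exact: continuous_width.
Qed.

Lemma norm_scaled_le x y z : 0 <= x <= 1 -> 0 <= y <= z -> `|x * y| <= z :> R.
Proof. by move=> x01 y0z; rewrite ger0_norm; [nra|apply: mulr_ge0; lra]. Qed.

Lemma continuous_loop_squeeze (X : topologicalType) (l c t b : X -> R) k
    (i : X -> comb_index) :
  continuous l -> continuous c -> continuous t -> continuous b -> continuous i ->
  (forall x, 0 <= c x < 1/2) -> (forall x, 0 <= l x <= 1) ->
  (forall x, 0 <= b x <= 1) ->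
  continuous (fun x => loop_squeeze (l x) k (c x) (i x) (t x) (b x)).
Proof.
move=> cl cc ct cb ci c2 l01 b01; rewrite /loop_squeeze.
have c2' x : c x < 1/2 by have := c2 x; lra.
have cs f : continuous f -> continuous (fun x => squeeze (c x) (f x)).
  by move=> cf; exact: continuous_squeeze.
apply: continuous_pair.
  apply: continuous_scale; last by apply: continuous_along_loop; exact: cs.
  apply: (@continuous_on_comb _ _ i _
    (fun n x => tooth R (Some n) * width (Some n) (squeeze (c x) (b x))) 1) => //.
  - move=> n; apply: continuous_mul; first exact: continuous_const.
    by apply: continuous_width; exact: cs.
  - by move=> x n ->.
  - move=> x; rewrite mulrC mul1r; apply: norm_scaled_le.
      exact/width_itv/squeeze_itv.
    by rewrite tooth_ge0 /=.
apply: continuous_pair; last exact: cs.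
apply: (@continuous_on_comb _ _ i _ (fun n x =>
  level (l x) k (c x) (depth (Some n) (t x) (b x)) * tooth R (Some n)) 1) => //.
- move=> n; apply: continuous_mul; last exact: continuous_const.
  by apply: continuous_level => //; exact: continuous_depth.
- by move=> x n ->.
- move=> x; rewrite mul1r; apply: norm_scaled_le; first exact: level_itv.
  by rewrite tooth_ge0 /=.
Qed.

Lemma continuous_slice_squeeze (X : topologicalType) (l c t b : X -> R) k
    (i : X -> comb_index) :
  continuous l -> continuous c -> continuous t -> continuous b -> continuous i ->
  (forall x, 0 <= c x < 1/2) -> (forall x, 0 <= l x <= 1) ->
  continuous (fun x => slice_squeeze (l x) k (c x) (i x) (t x) (b x)).
Proof.
move=> cl cc ct cb ci c2 l01; rewrite /slice_squeeze /fin.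
have c2' x : c x < 1/2 by have := c2 x; lra.
have cs f : continuous f -> continuous (fun x => squeeze (c x) (f x)).
  by move=> cf; exact: continuous_squeeze.
have s2 x : 0 <= slice (i x) (squeeze (c x) (t x)) (squeeze (c x) (b x))
    <= 2 * tooth R (i x).
  have /andP[lo hi] := slice_bounds (i x) (squeeze_itv (c x) (t x))
    (squeeze_itv (c x) (b x)).
  rewrite (le_trans (snake_ge0 _ (squeeze_itv _ _)) lo) /=.
  exact: le_trans hi (snake_le_tooth _ (squeeze_itv _ _)).
have cS n : continuous (fun x =>
    slice (Some n) (squeeze (c x) (t x)) (squeeze (c x) (b x))).
  have csn m : continuous (fun x => snake (Some m) (squeeze (c x) (b x))).
    by apply: continuous_snake_segment; exact: cs.
  apply: continuous_add; first exact: (csn n.+1).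
  apply: continuous_mul; first exact: cs.
  by apply: continuous_add => //; apply: continuous_opp; exact: (csn n.+1).
have cL n : continuous (fun x => level (l x) k (c x) (depth (Some n) (t x) (b x))).
  by apply: continuous_level => //; exact: continuous_depth.
have L01 x : 0 <= level (l x) k (c x) (depth (i x) (t x) (b x)) <= 1.
  exact: level_itv.
apply: continuous_pair; last exact: cs.
apply: continuous_pair.
- apply: (@continuous_on_comb _ _ i _ (fun n x =>
    level (l x) k (c x) (depth (Some n) (t x) (b x)) *
    slice (Some n) (squeeze (c x) (t x)) (squeeze (c x) (b x))) 2) => //.
  + by move=> n; exact: continuous_mul.
  + by move=> x n ->.
  + by move=> x; exact: norm_scaled_le.
- apply: (@continuous_on_comb _ _ i _ (fun n x =>
    level (l x) k (c x) (depth (Some n) (t x) (b x)) *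
    (1 - level (l x) k (c x) (depth (Some n) (t x) (b x))) *
    slice (Some n) (squeeze (c x) (t x)) (squeeze (c x) (b x))) 2) => //.
  + move=> n; apply: continuous_mul => //; apply: continuous_mul => //.
    by apply: continuous_add; [exact: continuous_const|exact: continuous_opp].
  + by move=> x n ->.
  + by move=> x; apply: norm_scaled_le => //; apply: scaled_itv => //;
      have := L01 x; lra.
Qed.

Lemma continuous_comb_tube : continuous (on_chart (tube d comb_pos comb_rad)).
Proof.
rewrite /on_chart /tube /comb_pos; apply: continuous_pair; last by continuity.
apply: continuous_scale; last by continuity.
apply: (@continuous_on_comb _ _ (fun y : comb_index * (I * I) => y.1) _
  (fun n y => tooth R (Some n) * width (Some n) (coord y.2.2)) 1) => //.
- by continuity.
- move=> n; apply: continuous_mul; first exact: continuous_const.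
  by apply: continuous_width; continuity.
- by move=> x n; rewrite /comb_rad => ->.
- move=> x; rewrite /comb_rad mulrC mul1r; apply: norm_scaled_le.
    exact/width_itv/coord_itv.
  by rewrite tooth_ge0 /=.
Qed.

Lemma comb_rad_eq0 i b : comb_rad i b = 0 -> width i b = 0.
Proof.
case: i => [n|] // /eqP; rewrite mulf_eq0 => /orP[/eqP e|/eqP //].
by have := tooth_gt0 R n; rewrite e ltxx.
Qed.

Lemma loop_squeeze_boundary l k c i t b : 0 <= c < 1/2 -> 1 - k * c <= l ->
  0 <= t <= 1 -> 0 <= b <= 1 -> t = 0 \/ t = 1 \/ width i b = 0 ->
  loop_squeeze l k c i t b = flat (l * tooth R i) (squeeze c b).
Proof.
move=> c2 kc t01 b01 h.
have d0 := depth_boundary t01 b01 h.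
by rewrite loop_squeeze_shallow ?d0 ?level0 //; case/andP: c2.
Qed.

Lemma slice_squeeze_bottom l k c i b : 0 <= c < 1/2 -> 1 - k * c <= l ->
  0 <= b <= 1 ->
  slice_squeeze l k c i 0 b = fin l (snake (next i) (squeeze c b)) (squeeze c b).
Proof.
move=> c2 kc b01; rewrite /slice_squeeze depth_boundary //; [|lra|by left].
by rewrite level0 // squeeze_le ?slice0 //; lra.
Qed.

Lemma slice_squeeze_top l k c i t b : 0 <= c < 1/2 -> 1 - k * c <= l ->
  0 <= t <= 1 -> 0 <= b <= 1 -> t = 1 \/ width i b = 0 ->
  slice_squeeze l k c i t b = fin l (snake i (squeeze c b)) (squeeze c b).
Proof.
move=> c2 kc t01 b01 h; rewrite /slice_squeeze depth_boundary //; last by right.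
rewrite level0 //; case: h => [->|w].
  by rewrite squeeze_ge ?slice1 //; lra.
by rewrite slice_width0 // width_squeeze // w squeeze_le //; lra.
Qed.

(** Two squeezes of parameter 1/3, each with slope 3, compose to a squeeze of
    parameter 4/9 with slope 9; the homotopies below start from these values. *)
Lemma level_squeeze i t b : 0 <= t <= 1 -> 0 <= b <= 1 -> 1/3 <= depth i t b ->
  level 0 3 (1/3) (depth i (squeeze (1/3) t) (squeeze (1/3) b)) =
  level 0 9 (4/9) (depth i t b).
Proof.
move=> t01 b01 h.
have h' : depth i t b <= 1/2 by rewrite /depth; elim_minmax; lra.
rewrite depth_squeeze; last by lra.
by rewrite squeeze_third clamp_id /level; [elim_minmax|]; lra.
Qed.

Lemma level_shallow i t b : depth i t b <= 1/3 ->
  level 0 9 (4/9) (depth i t b) = 0.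
Proof. by move=> h; rewrite /level; elim_minmax; lra. Qed.

Definition fins_to_base i t b s : ambient R := flat 0 (squeeze (1/3) b).
Definition slices_to_loops i t b s := loop_squeeze 0 3 (1/3) i t b.
Definition loops_to_slices i t b s := slice_squeeze 0 3 (1/3) i t b.
Definition square_to_base a b s : fin_ambient R := ((0, 0), squeeze (1/3) b).

(** Starts at 4/9, the value for a composite of two squeezes of parameter 1/3, and
    ends at 0, where the squeeze is the identity. *)
Definition param s : R := 4 * (1 - s) / 9.
Definition fins_shrinking i t b s :=
  fin (s * t) (snake i (squeeze (param s) b)) (squeeze (param s) b).
Definition slices_shrinking i t b s := slice_squeeze s 9 (param s) i t b.
Definition loops_shrinking i t b s := loop_squeeze s 9 (param s) i t b.
Definition square_shrinking a b s : ambient R := flat (s * a) (squeeze (param s) b).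

Lemma third_itv : 0 <= (1/3 : R) < 1/2. Proof. lra. Qed.

Lemma param_itv s : 0 <= s <= 1 -> 0 <= param s < 1/2.
Proof. rewrite /param; lra. Qed.

Lemma param_level s : 0 <= s <= 1 -> 1 - 9 * param s <= s.
Proof. rewrite /param; lra. Qed.

Lemma third_level : 1 - 3 * (1/3) <= 0 :> R. Proof. lra. Qed.

Lemma exists_slices_to_loops : exists F : M * I -> A,
  induced_map fins_to_base slices_to_loops F.
Proof.
have zero01 : 0 <= (0 : R) <= 1 by lra.
apply: (@map_from_mapping_cone R _ A _ _ (fun b _ => flat 0 (squeeze (1/3) b))).
- rewrite /on_chart_time /fins_to_base /flat; continuity.
  by move=> x; lra.
- rewrite /on_chart_time /slices_to_loops; apply: continuous_loop_squeeze;
    continuity => x; rewrite ?coord_itv //; lra.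
- by move=> i t b s t01 b01 s01; apply: comb_cones_flat => //; exact: squeeze_itv.
- by move=> i t b s t01 b01 s01; apply: loop_squeeze_in => //; lra.
- by [].
- by [].
- move=> i t b s t01 b01 s01 h; rewrite /slices_to_loops.
  rewrite loop_squeeze_boundary ?mul0r //; [exact: third_itv|exact: third_level|].
  by right.
- move=> i b s b01 s01; rewrite /slices_to_loops.
  rewrite loop_squeeze_boundary ?mul0r //; [exact: third_itv|exact: third_level|].
  by left.
Qed.

Lemma exists_loops_to_slices : exists F : A * I -> M,
  induced_map loops_to_slices (fun _ => square_to_base) F.
Proof.
apply: map_from_cone.
- exact: continuous_comb_tube.
- by move=> i j b b01 /tooth_inj ->.
- rewrite /on_chart_time /loops_to_slices; apply: continuous_slice_squeeze;
    continuity => x; rewrite ?coord_itv //; lra.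
- rewrite /on_chart_time /square_to_base; continuity.
  by move=> _; lra.
- by move=> i t b s t01 b01 s01; apply: slice_squeeze_in => //; lra.
- by move=> a b s a01 b01 s01; apply: mapping_cone_base; exact: squeeze_itv.
- by move=> i j t b s _ _ _ /tooth_inj ->.
- move=> i t b s t01 b01 s01 h; rewrite /loops_to_slices /slice_squeeze.
  rewrite depth_boundary //; last first.
    by case: h => [|[|/comb_rad_eq0]]; auto.
  by rewrite level0 ?fin_base ?mul0r //; exact: third_level.
Qed.

Lemma exists_slices_shrinking : exists F : M * I -> M,
  induced_map fins_shrinking slices_shrinking F.
Proof.
apply: (@map_from_mapping_cone R _ M _ _ (fun b s => ((0, 0), squeeze (param s) b))).
- rewrite /on_chart_time /fins_shrinking /fin /param.
  continuity => x; by [exact: squeeze_itv|have := coord_itv x.2; lra].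
- rewrite /on_chart_time /slices_shrinking /param; apply: continuous_slice_squeeze;
    continuity => x; have := coord_itv x.2; lra.
- move=> i t b s t01 b01 s01; apply: mapping_cone_fin; last exact: squeeze_itv.
  exact: scaled_itv.
- by move=> i t b s t01 b01 s01; apply: slice_squeeze_in => //; exact: param_itv.
- move=> i t b s t01 b01 s01 h; rewrite /fins_shrinking fin_base //.
  by case: h => ->; rewrite ?mulr0 ?mul0r.
- move=> i j t b s t01 b01 s01 e; rewrite /fins_shrinking.
  have p01 := param_itv s01.
  case: (snake_inj b01 e) => [-> //|b0|b1].
    by move: e; rewrite b0 squeeze_le => [->|//|] //; lra.
  by move: e; rewrite b1 squeeze_ge => [->|//|] //; lra.
- move=> i t b s t01 b01 s01 h; rewrite /slices_shrinking /fins_shrinking mulr1.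
  by rewrite slice_squeeze_top //; [exact: param_itv|exact: param_level].
- move=> i b s b01 s01; rewrite /slices_shrinking /fins_shrinking mulr1.
  by rewrite slice_squeeze_bottom //; [exact: param_itv|exact: param_level].
Qed.

Lemma exists_loops_shrinking : exists F : A * I -> A,
  induced_map loops_shrinking (fun _ => square_shrinking) F.
Proof.
apply: map_from_cone.
- exact: continuous_comb_tube.
- by move=> i j b b01 /tooth_inj ->.
- rewrite /on_chart_time /loops_shrinking /param; apply: continuous_loop_squeeze;
    continuity => x; rewrite ?coord_itv //; have := coord_itv x.2; lra.
- rewrite /on_chart_time /square_shrinking /flat /param; continuity.
  by move=> x; have := coord_itv x.2; lra.
- by move=> i t b s t01 b01 s01; apply: loop_squeeze_in => //; exact: param_itv.
- move=> a b s a01 b01 s01; apply: comb_cones_flat; last exact: squeeze_itv.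
  exact: scaled_itv.
- by move=> i j t b s _ _ _ /tooth_inj ->.
- move=> i t b s t01 b01 s01 h; rewrite /loops_shrinking loop_squeeze_boundary //.
  + exact: param_itv.
  + exact: param_level.
  + by case: h => [|[|/comb_rad_eq0]]; auto.
Qed.

(** A slice is sent to the loop of the cone of the same index, a loop to the slice
    together with the fins over its two ends. Composing, a slice acquires its two
    fins, and these are lowered by a homotopy that shrinks all fins to the left
    edge; a loop acquires a walk from the left edge and back, which is drawn in
    as the square is pushed onto that edge. *)
Lemma mapping_cone_comb_cones : homotopy_equivalent R M A.
Proof.
have [f [cf ff fs]] := exists_slices_to_loops.
have [g [cg gl gs]] := exists_loops_to_slices.
have [H [cH Hf Hs]] := exists_slices_shrinking.
have [K [cK Kl Ks]] := exists_loops_shrinking.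
have i0 : coord (to_unit 0) = 0 :> R by rewrite coordK //; lra.
have i1 : coord (to_unit 1) = 1 :> R by rewrite coordK //; lra.
have zero01 : 0 <= (0 : R) <= 1 by lra.
have zero1 : 0 <= 1 :> R by lra.
have three0 : 0 <= 3 :> R by lra.
have p0 : param 0 = 4/9 by rewrite /param; lra.
have p1 : param 1 = 0 by rewrite /param; lra.
have q01 := squeeze_itv.
apply: (homotopy_equivalent_of_families cf cg cH cK).
- move=> z; apply: val_inj; case: (set_typeP z) => i [t [b [t01 b01 [e|e]]]].
  + have := ff _ (to_unit 0) _ _ _ t01 b01 e; rewrite (Hf _ _ _ _ _ t01 b01 e) i0.
    move=> /(gs _ (to_unit 0) None _ _ zero01 (q01 _ _ _)) ->.
    rewrite /fins_shrinking p0 mul0r fin_base ?mul0r // /square_to_base.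
    by rewrite squeeze_squeeze.
  + have := fs _ (to_unit 0) _ _ _ t01 b01 e; rewrite (Hs _ _ _ _ _ t01 b01 e) i0.
    rewrite /slices_shrinking p0; case: (lerP (depth i t b) (1/3)) => h.
      rewrite /slices_to_loops loop_squeeze_shallow //; last exact: third_itv.
      move=> /(gs _ (to_unit 0) None _ _ _ (q01 _ _ _)) ->; last first.
        by apply: scaled_itv; [exact: level_itv|exact: tooth_itv].
      rewrite /slice_squeeze level_shallow // fin_base ?mul0r //.
      by rewrite /square_to_base squeeze_squeeze.
    rewrite /slices_to_loops (loop_squeeze_deep zero1 three0 (ltW h)).
    move=> /(gl _ (to_unit 0) _ _ _ (q01 _ _ _) (q01 _ _ _)) ->.
    rewrite /loops_to_slices /slice_squeeze (level_squeeze t01 b01 (ltW h)).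
    by rewrite !squeeze_squeeze.
- move=> z; apply: val_inj; case: (set_typeP z) => i [t [b [t01 b01 [e|e]]]].
  + by rewrite (Hf _ _ _ _ _ t01 b01 e) i1 e /fins_shrinking p1 mul1r !squeeze0.
  + rewrite (Hs _ _ _ _ _ t01 b01 e) i1 e /slices_shrinking p1.
    by rewrite slice_squeeze_deep ?squeeze0 // depth_ge0.
- move=> z; apply: val_inj; case: (set_typeP z) => i [t [b [t01 b01 [e|e]]]].
  + have := gl _ (to_unit 0) _ _ _ t01 b01 e; rewrite (Kl _ _ _ _ _ t01 b01 e) i0.
    rewrite /loops_shrinking p0; case: (lerP (depth i t b) (1/3)) => h.
      have [j e'] := slice_squeeze_shallow 0 3 third_itv h.
      rewrite /loops_to_slices e'.
      move=> /(ff _ (to_unit 0) _ _ _ (level_itv _ _ _ zero01) (q01 _ _ _)) ->.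
      rewrite loop_squeeze_shallow ?level_shallow ?mul0r //; [|lra..].
      by rewrite /fins_to_base squeeze_squeeze.
    rewrite /loops_to_slices (slice_squeeze_deep zero1 three0 (ltW h)).
    move=> /(fs _ (to_unit 0) _ _ _ (q01 _ _ _) (q01 _ _ _)) ->.
    rewrite /slices_to_loops /loop_squeeze (level_squeeze t01 b01 (ltW h)).
    by rewrite !squeeze_squeeze.
  + have := gs _ (to_unit 0) i _ _ t01 b01 e; rewrite (Ks _ _ i _ _ t01 b01 e) i0.
    rewrite /square_to_base -(@fin_base _ 0 (snake None (squeeze (1/3) b))) ?mul0r //.
    move=> /(ff _ (to_unit 0) None _ _ zero01 (q01 _ _ _)) ->.
    by rewrite /square_shrinking p0 mul0r /fins_to_base squeeze_squeeze.
- move=> z; apply: val_inj; case: (set_typeP z) => i [t [b [t01 b01 [e|e]]]].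
  + rewrite (Kl _ _ _ _ _ t01 b01 e) i1 e /loops_shrinking p1.
    by rewrite loop_squeeze_deep ?squeeze0 // depth_ge0.
  + by rewrite (Ks _ _ i _ _ t01 b01 e) i1 e /square_shrinking p1 mul1r squeeze0.
Qed.

End CombCones.

(** * The circle as a loop *)

Section CircleLoop.
Variable R : realType.
Implicit Types (t p q : R).

Definition chord_p t : R := 2 * t - 1.
Definition chord_q t : R := 1 - `|chord_p t|.
Definition chord_sq t : R := chord_p t ^+ 2 + chord_q t ^+ 2.

(** The second intersection of the unit circle with the line of slope
    [- chord_p t / chord_q t] through (1, 0): stereographic projection, after the
    homeomorphism from ]-1, 1[ to the line that sends [p] to [p / (1 - |p|)]. No
    trigonometry is involved, so that its bijectivity is a matter of algebra. *)
Definition unit_loop t : R * R :=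
  ((chord_p t ^+ 2 - chord_q t ^+ 2) / chord_sq t,
   (2 * chord_p t * chord_q t) / chord_sq t).

Lemma chord_sq_gt0 t : 0 < chord_sq t.
Proof.
rewrite lt0r addr_ge0 ?sqr_ge0 // andbT /chord_sq paddr_eq0 ?sqr_ge0 //.
rewrite !expf_eq0 /=; apply/negP => /andP[/eqP p0].
by rewrite /chord_q p0 normr0 subr0 oner_eq0.
Qed.

Lemma chord_sq_neq0 t : chord_sq t != 0.
Proof. exact/lt0r_neq0/chord_sq_gt0. Qed.

Lemma continuous_unit_loop : continuous unit_loop.
Proof.
have cp : continuous chord_p by rewrite /chord_p; continuity.
have cq : continuous chord_q.
  apply: continuous_add; first exact: continuous_const.
  apply: continuous_opp => t.
  apply: (@continuous_comp _ _ _ chord_p (fun x : R => `|x|)); first exact: cp.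
  exact: norm_continuous.
have cs : continuous chord_sq by apply: continuous_add; apply: continuous_mul.
have ci : continuous (fun t => (chord_sq t)^-1).
  by apply: continuous_inv => //; exact: chord_sq_neq0.
apply: continuous_pair; apply: continuous_mul => //.
  apply: continuous_add; first exact: continuous_mul.
  by apply: continuous_opp; exact: continuous_mul.
by apply: continuous_mul => //; apply: continuous_mul => //; exact: continuous_const.
Qed.

Lemma unit_loop_circle t : (unit_loop t).1 ^+ 2 + (unit_loop t).2 ^+ 2 = 1.
Proof. rewrite /= /chord_sq; field; exact: chord_sq_neq0. Qed.

Lemma unit_loop_end t : t = 0 \/ t = 1 -> unit_loop t = (1, 0).
Proof.
move=> h.
have p1 : `|chord_p t| = 1.
  case: h => ->; rewrite /chord_p; first by rewrite mulr0 sub0r normrN normr1.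
  have -> : 2 * 1 - 1 = 1 :> R by lra.
  exact: normr1.
have q0 : chord_q t = 0 by rewrite /chord_q p1 subrr.
have p2 : chord_p t ^+ 2 = 1 by rewrite -real_normK ?num_real // p1 expr1n.
by rewrite /unit_loop /chord_sq q0 p2 expr0n /= mulr0 mul0r subr0 addr0 divr1.
Qed.

Lemma chord_q_ge0 t : 0 <= t <= 1 -> 0 <= chord_q t.
Proof. by move=> t01; rewrite subr_ge0 ler_norml /chord_p; lra. Qed.

Lemma chord_q_eq0 t : chord_q t = 0 -> t = 0 \/ t = 1.
Proof.
rewrite /chord_q => /eqP; rewrite subr_eq0 eq_sym eqr_norml => /andP[+ _].
by rewrite /chord_p => /orP[] /eqP ?; [right|left]; lra.
Qed.

Lemma unit_loop_inj t t' : 0 <= t <= 1 -> 0 <= t' <= 1 ->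
  unit_loop t = unit_loop t' ->
  [\/ t = t', t = 0 /\ t' = 1 | t = 1 /\ t' = 0].
Proof.
move=> t01 t'01 [ex ey].
have D0 := chord_sq_neq0 t; have D'0 := chord_sq_neq0 t'.
have e1 : chord_q t ^+ 2 / chord_sq t = chord_q t' ^+ 2 / chord_sq t'.
  have h u : chord_q u ^+ 2 / chord_sq u =
      (1 - (chord_p u ^+ 2 - chord_q u ^+ 2) / chord_sq u) / 2.
    by rewrite /chord_sq; field; exact: chord_sq_neq0.
  by rewrite !h ex.
have e2 : chord_p t * chord_q t / chord_sq t =
    chord_p t' * chord_q t' / chord_sq t'.
  have h u : chord_p u * chord_q u / chord_sq u =
      (2 * chord_p u * chord_q u / chord_sq u) / 2.
    by rewrite /chord_sq; field; exact: chord_sq_neq0.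
  by rewrite !h ey.
have [q0|q0] := eqVneq (chord_q t) 0.
  have q'0 : chord_q t' = 0.
    move: e1; rewrite q0 expr0n /= mul0r => /esym/eqP.
    by rewrite mulf_eq0 invr_eq0 (negbTE D'0) orbF expf_eq0 => /eqP.
  by case: (chord_q_eq0 q0) (chord_q_eq0 q'0) => -> [] ->;
    [exact: Or31|exact: Or32|exact: Or33|exact: Or31].
have q'0 : chord_q t' != 0.
  apply: contraNneq q0 => q'0; move/eqP: e1; rewrite q'0 expr0n /= mul0r.
  by rewrite mulf_eq0 invr_eq0 (negbTE D0) orbF expf_eq0.
have cross : chord_p t * chord_q t' = chord_p t' * chord_q t.
  have : (chord_p t * chord_q t / chord_sq t) * (chord_q t' ^+ 2 / chord_sq t') =
      (chord_p t' * chord_q t' / chord_sq t') * (chord_q t ^+ 2 / chord_sq t).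
    by rewrite e1 e2.
  move=> h; apply: (mulIf (mulf_neq0 q0 q'0)).
  apply: (mulIf (mulf_neq0 (invr_neq0 D0) (invr_neq0 D'0))).
  by transitivity ((chord_p t * chord_q t / chord_sq t) *
    (chord_q t' ^+ 2 / chord_sq t')); [ring|rewrite h; ring].
have qt : 0 < chord_q t by rewrite lt0r q0 chord_q_ge0.
have qt' : 0 < chord_q t' by rewrite lt0r q'0 chord_q_ge0.
suff : chord_p t = chord_p t' by rewrite /chord_p => ?; apply: Or31; lra.
move: cross qt qt'; rewrite /chord_q.
case: (ger0P (chord_p t)); case: (ger0P (chord_p t')); move: (chord_p t) (chord_p t');
  move=> p p' *; nra.
Qed.

Lemma unit_loop_surj (x y : R) : x ^+ 2 + y ^+ 2 = 1 ->
  exists t, 0 <= t <= 1 /\ unit_loop t = (x, y).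
Proof.
move=> xy; have [x1|x1] := eqVneq x 1.
  have y0 : y = 0.
    by apply/eqP; rewrite -sqrf_eq0; apply/eqP; move: xy; rewrite x1 expr1n; lra.
  by exists 0; split; [lra|rewrite unit_loop_end ?x1 ?y0 //; left].
have x_lt1 : x < 1.
  rewrite lt_neqAle x1 /=; have := sqr_ge0 y; nra.
have y_norm : - `|y| <= y <= `|y| by rewrite -ler_norml.
pose N := 1 - x + `|y|.
have N0 : 0 < N by rewrite /N; have := normr_ge0 y; lra.
have N1 : N != 0 by exact: lt0r_neq0.
pose t := (y / N + 1) / 2.
have pE : chord_p t = y / N by rewrite /chord_p /t; field.
have qE : chord_q t = (1 - x) / N.
  rewrite /chord_q pE normrM normfV (gtr0_norm N0) /N; field.
  by rewrite -/N.
have sE : chord_sq t = 2 * (1 - x) / N ^+ 2.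
  rewrite /chord_sq pE qE !expr_div_n -mulrDl; congr (_ / _).
  rewrite sqrrB expr1n mul1r; have -> : y ^+ 2 = 1 - x ^+ 2 by rewrite -xy; ring.
  by rewrite mulr2n; ring.
have x0 : 1 - x != 0 by rewrite subr_eq0 eq_sym.
exists t; split.
  have : -1 <= y / N <= 1.
    by rewrite ler_pdivrMr // ler_pdivlMr // /N; lra.
  by rewrite /t; lra.
rewrite /unit_loop sE pE qE; congr pair; last by field; apply/andP.
have -> : (y / N) ^+ 2 - ((1 - x) / N) ^+ 2 = (1 - x ^+ 2 - (1 - x) ^+ 2) / N ^+ 2.
  by rewrite !expr_div_n -mulrBl -xy; congr (_ / _); ring.
by field; apply/andP.
Qed.

(** The rotation that takes (1, 0) to [x0], applied to the unit loop. *)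
Definition circle_point (x0 : circle R) t : R * R :=
  ((\val x0).1 * (unit_loop t).1 - (\val x0).2 * (unit_loop t).2,
   (\val x0).2 * (unit_loop t).1 + (\val x0).1 * (unit_loop t).2).

Lemma circleP (x0 : circle R) : (\val x0).1 ^+ 2 + (\val x0).2 ^+ 2 = 1.
Proof. exact: (set_typeP x0). Qed.

Lemma circle_point_circle x0 t : circle R (circle_point x0 t).
Proof.
move: (circleP x0) (unit_loop_circle t); rewrite /circle /circle_point.
move: (\val x0) (unit_loop t) => [x y] [X Y] /= c u.
transitivity ((x ^+ 2 + y ^+ 2) * (X ^+ 2 + Y ^+ 2)); first by ring.
by rewrite c u mulr1.
Qed.

Lemma circle_point_end x0 t : t = 0 \/ t = 1 -> circle_point x0 t = \val x0.
Proof.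
move=> /unit_loop_end h; rewrite /circle_point h /= !mulr1 !mulr0 subr0 addr0.
by case: (\val x0).
Qed.

Lemma circle_point_unit x0 t t' :
  circle_point x0 t = circle_point x0 t' -> unit_loop t = unit_loop t'.
Proof.
have inv u : unit_loop u =
    ((\val x0).1 * (circle_point x0 u).1 + (\val x0).2 * (circle_point x0 u).2,
     (\val x0).1 * (circle_point x0 u).2 - (\val x0).2 * (circle_point x0 u).1).
  move: (circleP x0); rewrite /circle_point.
  move: (\val x0) (unit_loop u) => [x y] [X Y] /= c.
  by congr pair; rewrite -[LHS]mul1r -c; ring.
by move=> e; rewrite (inv t) e -inv.
Qed.

Lemma continuous_circle_point x0 : continuous (circle_point x0).
Proof.
have c1 : continuous (fun t => (unit_loop t).1).
  by apply: continuous_fst_of; exact: continuous_unit_loop.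
have c2 : continuous (fun t => (unit_loop t).2).
  by apply: continuous_snd_of; exact: continuous_unit_loop.
apply: continuous_pair; apply: continuous_add; try apply: continuous_opp;
  by apply: continuous_mul => //; exact: continuous_const.
Qed.

Lemma circle_point_surj x0 (z : circle R) :
  exists t, 0 <= t <= 1 /\ circle_point x0 t = \val z.
Proof.
have c := circleP x0; have cz := circleP z.
have [|t [t01 tE]] := @unit_loop_surj
  ((\val x0).1 * (\val z).1 + (\val x0).2 * (\val z).2)
  ((\val x0).1 * (\val z).2 - (\val x0).2 * (\val z).1).
  transitivity (((\val x0).1 ^+ 2 + (\val x0).2 ^+ 2) *
    ((\val z).1 ^+ 2 + (\val z).2 ^+ 2)); first by ring.
  by rewrite c cz mulr1.
exists t; split=> //; rewrite /circle_point tE /= [RHS]surjective_pairing.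
by congr pair; rewrite -[RHS]mul1r -c /=; ring.
Qed.

Definition displacement (x0 z : R * R) : R * R := (z.1 - x0.1, z.2 - x0.2).

Lemma displacement_inj x0 : injective (displacement x0).
Proof. by move=> [x y] [x' y'] [/addIr -> /addIr ->]. Qed.

Lemma displacement_refl x0 : displacement x0 x0 = (0, 0).
Proof. by rewrite /displacement !subrr. Qed.

Lemma continuous_displacement x0 (X : topologicalType) (f : X -> R * R) :
  continuous f -> continuous (fun x => displacement x0 (f x)).
Proof.
move=> cf; apply: continuous_pair; apply: continuous_add;
  try exact: continuous_const.
  exact: continuous_fst_of.
exact: continuous_snd_of.
Qed.

Definition circle_displacement (x0 : circle R) t : R * R :=
  displacement (\val x0) (circle_point x0 t).

Lemma continuous_circle_displacement x0 : continuous (circle_displacement x0).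
Proof.
exact: (continuous_displacement (@continuous_circle_point x0)).
Qed.

Lemma circle_displacement_end x0 t : t = 0 \/ t = 1 ->
  circle_displacement x0 t = (0, 0).
Proof.
by move=> h; rewrite /circle_displacement circle_point_end // displacement_refl.
Qed.

Lemma circle_displacement_inj x0 t t' : 0 <= t <= 1 -> 0 <= t' <= 1 ->
  circle_displacement x0 t = circle_displacement x0 t' ->
  [\/ t = t', t = 0 /\ t' = 1 | t = 1 /\ t' = 0].
Proof.
by move=> t01 t'01 /displacement_inj/circle_point_unit; exact: unit_loop_inj.
Qed.

Definition circle_loop (x0 : circle R) : based_loop R :=
  BasedLoop (@continuous_circle_displacement x0)
    (circle_displacement_end x0 (or_introl erefl))
    (circle_displacement_end x0 (or_intror erefl))
    (@circle_displacement_inj x0).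

End CircleLoop.

(** * Identification of the two gluings *)

Section Gluing.
Variables (Z : topologicalType) (r : Z -> Z -> Prop).

Definition glue_class (z : Z) : gluing r :=
  (\pi_(quotient_topology {eq_quot glue_equiv r}) z)%qT.

Lemma continuous_glue_class : continuous glue_class.
Proof. exact: pi_continuous. Qed.

Lemma glue_class_surj (u : gluing r) : exists z, glue_class z = u.
Proof. by exists (repr u); exact: reprK. Qed.

Lemma glue_class_eq z z' : r z z' -> glue_class z = glue_class z'.
Proof.
by move=> zz'; apply/eqquotP/asboolP; exact: Relation_Operators.rst_step.
Qed.

Lemma map_from_gluing (W : topologicalType) (F : Z -> W) :
  continuous F -> (forall z z', r z z' -> F z = F z') ->
  exists2 G : gluing r -> W, continuous G & forall z, G (glue_class z) = F z.
Proof.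
move=> cF rF.
have FE z z' : glue_class z = glue_class z' -> F z = F z'.
  move=> /eqquotP/asboolP; elim=> [x y /rF //|x //|x y _ -> //|x y y' _ -> _ -> //].
exists (F \o repr).
  apply: repr_comp_continuous => // a b /eqP ab; apply/eqP; exact: FE.
by move=> z /=; apply: FE; rewrite /glue_class reprK.
Qed.

(** The map from the gluing induced by [F] is a continuous bijection. Its inverse
    is continuous because it can be computed on the compact charts, by means of
    their lifts [P] and [Q] to [Z]. *)
Lemma gluing_chart_space (R : realType) (E : topologicalType)
    (p q : comb_index -> R -> R -> E) (F : Z -> chart_space p q)
    (P Q : comb_index * (@unit_interval R * @unit_interval R) -> Z) :
  hausdorff_space E -> continuous (on_chart p) -> continuous (on_chart q) ->
  continuous F -> continuous P -> continuous Q ->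
  (forall k, F (P k) = chart_p p q k) -> (forall k, F (Q k) = chart_q p q k) ->
  (forall z z', r z z' -> F z = F z') ->
  (forall z z', F z = F z' -> glue_class z = glue_class z') ->
  homotopy_equivalent R (gluing r) (chart_space p q).
Proof.
move=> hE cp cq cF cP cQ FP FQ rF inj.
have [G cG GE] := map_from_gluing cF rF.
have cK (K : comb_index * (@unit_interval R * @unit_interval R) -> Z) :
    continuous K ->
    continuous (fun ks : comb_index * (@unit_interval R * @unit_interval R) *
      @unit_interval R => glue_class (K ks.1)).
  move=> cK; apply: (continuous_compose _ continuous_glue_class).
  by apply: continuous_compose cK; exact: continuous_fst.
have [|||H [cH HP HQ]] := map_from_chart_space hE cp cq (cK _ cP) (cK _ cQ).
- by move=> x y s e; apply: inj; rewrite !FP.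
- by move=> x y s e; apply: inj; rewrite FP FQ.
- by move=> x y s e; apply: inj; rewrite !FQ.
pose H0 z := H (z, to_unit 0).
have cH0 : continuous H0.
  by apply: (continuous_compose _ cH); continuity.
have H0F z : H0 (F z) = glue_class z.
  case: (chart_space_cover (F z)) => -[k kz]; rewrite -kz /H0.
    by rewrite HP; apply: inj; rewrite FP.
  by rewrite HQ; apply: inj; rewrite FQ.
apply: (homeomorphic_homotopy_equivalent R cG cH0).
- by move=> u; have [z <-] := glue_class_surj u; rewrite GE H0F.
- move=> w; case: (chart_space_cover w) => -[k <-].
    by rewrite -FP H0F GE.
  by rewrite -FQ H0F GE.
Qed.

End Gluing.

Section SnakeCone.
Variables (R : realType) (x0 : circle R).
Notation I := (@unit_interval R).
Notation d := (circle_loop x0).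

Lemma limit_segP (p : plane R) :
  limit_seg p <-> p.1 = 0 /\ 0 <= p.2 <= 1.
Proof.
rewrite /limit_seg /segment; split=> [[t /=]|].
  by rewrite in_itv /= => t01 <- /=; rewrite !mulr0 addr0 add0r mulr1.
case: p => [a b] /= [-> b01]; exists b; first by rewrite /= in_itv.
by rewrite /= !mulr0 addr0 add0r mulr1.
Qed.

Lemma sine_curveP (p : plane R) :
  sine_curve p <-> exists i b, 0 <= b <= 1 /\ p = (snake i b, b).
Proof.
split.
  case=> [/limit_segP [p1 p2]|[[|n] // _ [|]]].
  - by exists None, p.2; split=> //; rewrite /= -p1 -surjective_pairing.
  - case=> t; rewrite /= in_itv /= => t01 <-; exists (Some n.*2), t; split=> //.
    rewrite /= odd_double doubleK; congr pair; ring.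
  - case=> t; rewrite /= in_itv /= => t01 <-; exists (Some n.*2.+1), (1 - t).
    split; first by lra.
    rewrite /= odd_double /= uphalf_double; congr pair; ring.
case=> -[n|] [b [b01 ->]]; last by left; apply/limit_segP.
right; exists (n./2).+1 => //; case: (boolP (odd n)) => on /=.
- right; exists (1 - b); first by rewrite /= in_itv /=; lra.
  by rewrite /= on; congr pair; ring.
- left; exists b; first by rewrite /= in_itv /=.
  by rewrite /= (negbTE on); congr pair; ring.
Qed.

Lemma sine_curve_itv (p : plane R) : sine_curve p ->
  0 <= p.1 <= 1 /\ 0 <= p.2 <= 1.
Proof. by move=> /sine_curveP[i [b [b01 ->]]] /=; rewrite snake_itv. Qed.

Lemma squareP (p : plane R) : square p <-> 0 <= p.1 <= 1 /\ 0 <= p.2 <= 1.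
Proof. by rewrite /square /= !in_itv. Qed.

Lemma snake_in_sine_curve i b : 0 <= b <= 1 -> @sine_curve R (snake i b, b).
Proof. by move=> b01; apply/sine_curveP; exists i, b. Qed.

Notation sum := (topological_sum (circle R * @sine_curve R)%type (@square R)).

Definition in_tube (z : circle R) (p : @sine_curve R) : sum :=
  existT (summand (circle R * @sine_curve R)%type (@square R)) true (z, p).
Definition in_square (s : @square R) : sum :=
  existT (summand (circle R * @sine_curve R)%type (@square R)) false s.

Definition snake_cone_value (u : sum) : ambient R :=
  match u with
  | existT true zp => (scale (\val zp.2).1 (displacement (\val x0) (\val zp.1)),
                       \val zp.2)
  | existT false s => ((0, 0), \val s)
  end.

Lemma snake_cone_value_in u : snake_tubes d (snake_cone_value u).
Proof.
case: u => -[] /=.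
- move=> [z p] /=; have [i [b [b01 pE]]] := (sine_curveP (\val p)).1 (set_typeP p).
  have [t [t01 tE]] := circle_point_surj x0 z.
  exists i, t, b; split=> //; left.
  by rewrite pE /= -tE.
- move=> s; have [a01 b01] := (squareP (\val s)).1 (set_typeP s).
  rewrite (surjective_pairing (\val s)).
  exact: snake_tubes_flat.
Qed.

Lemma continuous_snake_cone_value : continuous snake_cone_value.
Proof.
pose f b : summand (circle R * @sine_curve R)%type (@square R) b -> ambient R :=
  fun x => snake_cone_value (existT _ b x).
suff cf b : continuous (f b).
  by move=> [b x] U nU; apply: (@existT_continuous _ _ b x); exact: (cf b x U nU).
case: b; rewrite /f /=.
- have c1 : continuous (fun zp : circle R * @sine_curve R => \val zp.1).
    by apply: (continuous_compose _ (@continuous_set_val _ _)); exact: continuous_fst.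
  have c2 : continuous (fun zp : circle R * @sine_curve R => \val zp.2).
    by apply: (continuous_compose _ (@continuous_set_val _ _)); exact: continuous_snd.
  apply: continuous_pair => //; apply: continuous_scale.
    exact: continuous_fst_of.
  exact: continuous_displacement.
- apply: continuous_pair; first exact: continuous_const.
  exact: continuous_set_val.
Qed.

Lemma snake_glue_value u v : snake_glue x0 u v ->
  snake_cone_value u = snake_cone_value v.
Proof.
case: u v => -[] u [] [] v //=.
case: u => z p /= [-> h]; congr pair; case: h => [[_ ->]|].
  by rewrite displacement_refl scale_origin.
by move=> /limit_segP[-> _]; rewrite scale0.
Qed.

Lemma glue_limit z (p : @sine_curve R) (s : @square R) :
  \val p = \val s -> (\val p).1 = 0 ->
  glue_class (snake_glue x0) (in_tube z p) = glue_class (snake_glue x0) (in_square s).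
Proof.
move=> ps p0; apply: glue_class_eq; split=> //; right; apply/limit_segP; split=> //.
by have [] := sine_curve_itv (set_typeP p).
Qed.

Lemma glue_base (p : @sine_curve R) (s : @square R) :
  \val p = \val s ->
  glue_class (snake_glue x0) (in_tube x0 p) = glue_class (snake_glue x0) (in_square s).
Proof.
move=> ps; have [p0|p0] := eqVneq (\val p).1 0; first exact: glue_limit.
apply: glue_class_eq; split=> //; left; split=> //; split; first exact: set_typeP.
by move=> /limit_segP[/eqP]; rewrite (negbTE p0).
Qed.

Lemma snake_value_inj u v : snake_cone_value u = snake_cone_value v ->
  glue_class (snake_glue x0) u = glue_class (snake_glue x0) v.
Proof.
have tube_square z p s : snake_cone_value (in_tube z p) = snake_cone_value (in_square s) ->
    glue_class (snake_glue x0) (in_tube z p) = glue_class (snake_glue x0) (in_square s).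
  move=> /= e; have ps := congr1 snd e; have := congr1 fst e => /=.
  rewrite -(scale_origin (\val p).1) -(displacement_refl (\val x0)).
  case/scale_inj => [p0|/displacement_inj/val_inj ->]; first exact: glue_limit.
  exact: glue_base.
case: u v => -[] u [] [] v; last first.
- by move=> /= e; congr glue_class; congr existT; apply: val_inj; exact: (congr1 snd e).
- by case: v => z p e; apply/esym/tube_square.
- by case: u => z p; exact: tube_square.
case: u v => [z p] [z' p'] /= e; have pp' : p = p' by apply/val_inj/(congr1 snd e).
subst p'; have := congr1 fst e => /=.
case/scale_inj => [p0|/displacement_inj/val_inj -> //].
have sq : square (\val p) by apply/squareP; exact: sine_curve_itv (set_typeP p).
pose s : @square R := exist _ (\val p) (mem_set sq).
by rewrite -[LHS]/(glue_class (snake_glue x0) (in_tube z p))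
  -[RHS]/(glue_class (snake_glue x0) (in_tube z' p)) !(@glue_limit _ _ s).
Qed.

Lemma snake_cone_tubes :
  homotopy_equivalent R (snake_cone R x0) (snake_tubes d).
Proof.
pose F := lift snake_cone_value_in.
pose cpt : I -> circle R := lift (fun t => circle_point_circle x0 (coord t)).
pose spt : comb_index * I -> @sine_curve R :=
  lift (fun ib : comb_index * I => snake_in_sine_curve ib.1 (coord_itv ib.2)).
have sqP (ab : I * I) : square (coord ab.1, coord ab.2).
  by apply/squareP; split; exact: coord_itv.
pose P (k : comb_index * (I * I)) := in_tube (cpt k.2.1) (spt (k.1, k.2.2)).
pose Q (k : comb_index * (I * I)) := in_square (lift sqP k.2).
apply: (@gluing_chart_space _ _ _ _ _ _ F P Q).
- exact: hausdorff_ambient.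
- exact: continuous_snake_tube.
- exact: continuous_flat_chart.
- by apply: continuous_lift; exact: continuous_snake_cone_value.
- apply: (continuous_compose _ (@existT_continuous _ _ true)).
  apply: continuous_pair.
    apply: (@continuous_compose _ _ _ (fun k : comb_index * (I * I) => k.2.1) cpt).
      by continuity.
    apply: continuous_lift.
    apply: (@continuous_compose _ _ _ (@coord R) (circle_point x0)).
      exact: continuous_set_val.
    exact: continuous_circle_point.
  apply: (@continuous_compose _ _ _ (fun k : comb_index * (I * I) => (k.1, k.2.2)) spt).
    by continuity.
  by apply: continuous_lift; continuity => x; exact: coord_itv.
- apply: (continuous_compose _ (@existT_continuous _ _ false)).
  apply: (@continuous_compose _ _ _ (fun k : comb_index * (I * I) => k.2) (lift sqP)).
    by continuity.
  by apply: continuous_lift; continuity.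
- by move=> k; apply: val_inj.
- by move=> k; apply: val_inj.
- by move=> u v uv; apply: val_inj; exact: snake_glue_value.
- by move=> u v /(congr1 val); exact: snake_value_inj.
Qed.

End SnakeCone.

Section AlternatingCone.
Variables (R : realType) (x0 : circle R).
Notation I := (@unit_interval R).
Notation d := (circle_loop x0).

Notation Y := (@alt_space R (circle R) x0).

Definition tooth_index (a : R) : comb_index := xget None [set i | tooth R i = a].

Lemma tooth_indexK i : tooth_index (tooth R i) = i.
Proof. by rewrite /tooth_index; case: xgetP => [j _ /tooth_inj //|/(_ i)/(_ erefl)]. Qed.

(** The height is reversed: the cone over the first tooth is collapsed at the
    bottom, while the first two segments of the snake meet at the top. *)
Definition alt_value (y : circle R * plane R) : ambient R :=
  (scale (comb_rad (tooth_index y.2.1) (1 - y.2.2))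
     (displacement (\val x0) (\val y.1)), (y.2.1, 1 - y.2.2)).

Lemma alt_spaceP (z : circle R) (p : plane R) : Y (z, p) <->
  0 <= p.2 <= 1 /\ ((exists i, p.1 = tooth R i) \/ z = x0 /\ 0 <= p.1 <= 1).
Proof.
split.
  case=> [[|[[|n] // _]]|]; rewrite /= ?in_itv /=.
  - by move=> [_ [p1 p2]]; split=> //; left; exists None.
  - by move=> [_ [p1 p2]]; split=> //; left; exists (Some n).
  - by move=> [zx [p1 p2]]; split=> //; right.
case=> p2 [[[n|] p1]|[zx p1]].
- by left; right; exists n.+1 => //; split=> //; split=> //; rewrite /= in_itv.
- by left; left; split=> //; split=> //; rewrite /= in_itv.
- by right; split=> //; split; rewrite /= in_itv.
Qed.

Definition alt_circle (t : I) : circle R :=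
  lift (fun t : I => circle_point_circle x0 (coord t)) t.

Lemma alt_loop_in (k : comb_index * (I * I)) :
  Y (alt_circle k.2.1, (tooth R k.1, 1 - coord k.2.2)).
Proof.
apply/alt_spaceP; split; last by left; exists k.1.
by have /= := coord_itv k.2.2; lra.
Qed.

Lemma alt_square_in (k : comb_index * (I * I)) :
  Y (x0, (coord k.2.1, 1 - coord k.2.2)).
Proof.
apply/alt_spaceP; split; last by right; split=> //; exact: coord_itv.
by have /= := coord_itv k.2.2; lra.
Qed.

Lemma alt_value_loop k :
  alt_value (\val (lift alt_loop_in k)) =
  on_chart (tube d (@comb_pos R) (@comb_rad R)) k.
Proof. by rewrite /alt_value /= tooth_indexK subKr. Qed.

Lemma alt_value_square k :
  alt_value (\val (lift alt_square_in k)) =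
  on_chart (fun _ : comb_index => @flat R) k.
Proof. by rewrite /alt_value /= displacement_refl scale_origin subKr. Qed.

Lemma alt_space_cover (y : Y) :
  (exists k, lift alt_loop_in k = y) \/ (exists k, lift alt_square_in k = y).
Proof.
case: y => -[z p] h; have /alt_spaceP[p2 hp] := set_mem h.
have p2' : 0 <= 1 - p.2 <= 1 by lra.
case: hp => [[i p1]|[zx p1]]; [left|right].
- have [t [t01 tE]] := circle_point_surj x0 z.
  exists (i, (to_unit t, to_unit (1 - p.2))); apply: val_inj => /=.
  rewrite coordK // subKr -p1 -surjective_pairing; congr pair.
  by apply: val_inj; rewrite /= coordK.
- exists (None, (to_unit p.1, to_unit (1 - p.2))); apply: val_inj => /=.
  by rewrite !coordK // subKr zx -surjective_pairing.
Qed.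

Lemma continuous_alt_loop : continuous (lift alt_loop_in).
Proof.
apply: continuous_lift; apply: continuous_pair; last by continuity.
apply: (@continuous_compose _ _ _ (fun k : comb_index * (I * I) => k.2.1)).
  by continuity.
apply: continuous_lift.
apply: (@continuous_compose _ _ _ (@coord R) (circle_point x0)).
  exact: continuous_set_val.
exact: continuous_circle_point.
Qed.

Lemma continuous_alt_square : continuous (lift alt_square_in).
Proof. by apply: continuous_lift; continuity. Qed.

Lemma hausdorff_alt_space : hausdorff_space Y.
Proof.
apply: (injective_hausdorff (@continuous_set_val _ _) val_inj).
apply: hausdorff_pair; last exact: hausdorff_plane.
by apply: (injective_hausdorff (@continuous_set_val _ _) val_inj); exact: hausdorff_plane.
Qed.

Lemma alt_value_in (y : Y) : comb_cones d (alt_value (\val y)).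
Proof.
case: (alt_space_cover y) => -[k <-].
  rewrite alt_value_loop.
  exact: (chart_space_p _ _ k.1 (coord_itv k.2.1) (coord_itv k.2.2)).
rewrite alt_value_square.
exact: (chart_space_q _ _ k.1 (coord_itv k.2.1) (coord_itv k.2.2)).
Qed.

Lemma continuous_alt_value : continuous (fun y : Y => alt_value (\val y)).
Proof.
apply: (@continuous_on_charts _ _ _ _ (lift alt_loop_in) (lift alt_square_in)).
- exact: hausdorff_alt_space.
- exact: compact_chart.
- exact: compact_chart.
- exact: continuous_alt_loop.
- exact: continuous_alt_square.
- exact: alt_space_cover.
- have -> : (fun k => alt_value (\val (lift alt_loop_in k))) =
      on_chart (tube d (@comb_pos R) (@comb_rad R)).
    by apply/funext => k; exact: alt_value_loop.
  exact: continuous_comb_tube.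
- have -> : (fun k => alt_value (\val (lift alt_square_in k))) =
      on_chart (fun _ : comb_index => @flat R).
    by apply/funext => k; exact: alt_value_square.
  exact: continuous_flat_chart.
Qed.

Lemma alt_collapsed_radius C (y : circle R * plane R) : @alt_collapsed R (circle R) C -> C y ->
  comb_rad (tooth_index y.2.1) (1 - y.2.2) = 0 /\
  forall y', C y' -> y'.2 = y.2.
Proof.
case=> [[[b _ <-]|[n n0 <-]]|[n n0 <-]] /= [_ ->] /=; split=> //;
  try by move=> y' [_ ->].
- by rewrite -[0]/(tooth R None) tooth_indexK /comb_rad mul0r.
- case: n n0 => [//|n] _.
  have -> : (2 * n.+1 - 1)%N = n.*2.+1 by rewrite mul2n doubleS subn1.
  rewrite -[_^-1]/(tooth R (Some n.*2)) tooth_indexK /comb_rad /= odd_double.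
  by rewrite subr0 subrr mulr0.
- case: n n0 => [//|n] _.
  have -> : (2 * n.+1)%N = n.*2.+2 by rewrite mul2n doubleS.
  rewrite -[_^-1]/(tooth R (Some n.*2.+1)) tooth_indexK /comb_rad /= odd_double.
  by rewrite subrr mulr0.
Qed.

Lemma alt_glue_value (u v : Y) : alt_glue u v ->
  alt_value (\val u) = alt_value (\val v).
Proof.
case=> C cC [Cu Cv]; have [ru uv] := alt_collapsed_radius cC Cu.
have [rv _] := alt_collapsed_radius cC Cv.
by rewrite /alt_value ru rv !scale0 (uv _ Cv).
Qed.

(** A point over the base point, off the comb, is alone in its class. On the comb
    either the radius is positive, and the two points coincide, or it vanishes,
    which happens only on the limit tooth and at the collapsed end of another. *)
Lemma alt_value_inj (u v : Y) : alt_value (\val u) = alt_value (\val v) ->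
  glue_class (@alt_glue R (circle R) x0) u = glue_class (@alt_glue R (circle R) x0) v.
Proof.
move=> e.
have p1 := congr1 (fun w => w.2.1) e; have p2 := congr1 (fun w => 1 - w.2.2) e.
move: p1 p2 => /= p1; rewrite !subKr => p2.
have p12 : (\val u).2 = (\val v).2.
  by rewrite [LHS]surjective_pairing [RHS]surjective_pairing p1 p2.
have same : (\val u).1 = (\val v).1 ->
    glue_class (@alt_glue R (circle R) x0) u = glue_class (@alt_glue R (circle R) x0) v.
  move=> z; congr glue_class; apply: val_inj.
  by rewrite [LHS]surjective_pairing [RHS]surjective_pairing z p12.
have := congr1 fst e; rewrite /alt_value /= p12.
case/scale_inj => [rad0|/displacement_inj/val_inj]; last exact: same.
have /alt_spaceP[b01 hu] : Y ((\val u).1, (\val u).2).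
  by rewrite -surjective_pairing; exact: set_typeP.
have /alt_spaceP[_ hv] : Y ((\val v).1, (\val v).2).
  by rewrite -surjective_pairing; exact: set_typeP.
have [[i iE]|no] := pselect (exists i, (\val v).2.1 = tooth R i); last first.
  case: hv => [//|[zv _]]; case: hu => [|[zu _]]; first by rewrite p12.
  by apply: same; rewrite zu zv.
apply: glue_class_eq; move: rad0; rewrite iE tooth_indexK => /comb_rad_eq0.
have collapse C : @alt_collapsed R (circle R) C -> C ((\val u).1, (\val v).2) ->
    C ((\val v).1, (\val v).2) -> alt_glue u v.
  by move=> cC Cu Cv; exists C => //; split; [move: Cu; rewrite -p12|move: Cv];
    rewrite -surjective_pairing.
rewrite p12 in b01.
case: i iE => [n|] iE /=; last first.
  move=> _; apply: (collapse ([set: circle R] `*` [set (0, (\val v).2.2)])).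
  - by left; left; exists (\val v).2.2 => //=; rewrite in_itv.
  - by split=> //=; rewrite {1}(surjective_pairing (\val v).2) iE.
  - by split=> //=; rewrite {1}(surjective_pairing (\val v).2) iE.
case: (boolP (odd n)) => on b0.
  have b1 : (\val v).2.2 = 1 by move: b0; lra.
  have nE : (2 * (n./2).+1)%N = n.+1.
    by rewrite mul2n doubleS -{2}(odd_double_half n) on.
  have vE : (\val v).2 = ptB R (2 * (n./2).+1)%N.
    by rewrite (surjective_pairing (\val v).2) iE b1 /ptB nE.
  by apply: (collapse ([set: circle R] `*` [set ptB R (2 * (n./2).+1)%N]));
    [right; exists (n./2).+1|split=> //=; rewrite vE|split=> //=; rewrite vE].
have b1 : (\val v).2.2 = 0 by move: b0; lra.
have nE : (2 * (n./2).+1 - 1)%N = n.+1.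
  by rewrite mul2n doubleS subn1 /= -{2}(odd_double_half n) (negbTE on).
have vE : (\val v).2 = ptA R (2 * (n./2).+1 - 1)%N.
  by rewrite (surjective_pairing (\val v).2) iE b1 /ptA nE.
by apply: (collapse ([set: circle R] `*` [set ptA R (2 * (n./2).+1 - 1)%N]));
  [left; right; exists (n./2).+1|split=> //=; rewrite vE|split=> //=; rewrite vE].
Qed.

Lemma alternating_cone_cones :
  homotopy_equivalent R (alternating_cone R x0) (comb_cones d).
Proof.
apply: (@gluing_chart_space _ _ _ _ _ _ (lift alt_value_in)
  (lift alt_loop_in) (lift alt_square_in)).
- exact: hausdorff_ambient.
- exact: continuous_comb_tube.
- exact: continuous_flat_chart.
- by apply: continuous_lift; exact: continuous_alt_value.
- exact: continuous_alt_loop.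
- exact: continuous_alt_square.
- by move=> k; apply: val_inj; exact: alt_value_loop.
- by move=> k; apply: val_inj; exact: alt_value_square.
- by move=> u v uv; apply: val_inj; exact: alt_glue_value.
- by move=> u v /(congr1 val); exact: alt_value_inj.
Qed.

End AlternatingCone.

Theorem theorem1p2 (R : realType) (x0 : circle R) :
  homotopy_equivalent R (snake_cone R x0) (alternating_cone R x0).
Proof.
apply: homotopy_equivalent_trans (snake_cone_tubes x0) _.
apply: homotopy_equivalent_trans (snake_tubes_mapping_cone _) _.
apply: homotopy_equivalent_trans (mapping_cone_comb_cones (circle_loop x0)) _.
exact/homotopy_equivalent_sym/alternating_cone_cones.
Qed.
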